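(* Let $M$ be a non-compact simply connected Riemannian surface and let $\tau\in\mathcal{C}^\infty(M)$. If there exists a (connected) complete spacelike surface $\Sigma$ in $\mathbb{L}^3(M,\tau)$, then $\Sigma$ is an entire graph and $M$ is also complete.
   Context: Space: $M$ is conformally parametrized as $M=(\Omega,\delta^{-2}(dx^2+dy^2))$, where $\Omega\subseteq\mathbb{R}^2$ is open and star-shaped with respect to the origin (e.g. a disk or the whole plane) and $\delta\in\mathcal{C}^\infty(\Omega)$ is positive. For $\tau\in\mathcal{C}^\infty(M)$, the Calabi potential is $$\mathbf{C}_{\delta,\tau}(x,y)=2\int_0^1 t\,\frac{\tau(tx,ty)}{\delta(tx,ty)^2}\,dt ,$$ and $\mathbb{L}^3(M,\tau)$ denotes $\Omega\times\mathbb{R}$, with coordinates $(x,y,z)$, endowed with the Lorentzian metric $$\frac{1}{\delta^2}(dx^2+dy^2)-\left(dz-\mathbf{C}_{\delta,\tau}(y\,dx-x\,dy)\right)^2 .$$ A spacelike surface is a smooth immersed surface whose induced metric is Riemannian; it is complete if this induced metric is complete. An entire graph is a surface of the form $\{(x,y,u(x,y)):(x,y)\in\Omega\}$ for a function $u$ on the whole of $\Omega$. *)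

(* Defs.v *)
From HB Require Import structures.
From mathcomp Require Import all_boot all_order all_algebra.
From mathcomp Require Import all_classical all_reals all_analysis.

Set Implicit Arguments.
Unset Strict Implicit.
Unset Printing Implicit Defensive.

Import Order.TTheory GRing.Theory Num.Theory.
Import numFieldNormedType.Exports.

Local Open Scope classical_set_scope.
Local Open Scope ring_scope.

(* [Ck_on k U f] and [smooth_on U f] are meant for open sets [U]; for such [U]
   they depend only on the restriction of [f] to [U]. *)
Fixpoint Ck_on (R : realType) (V W : normedModType R) (k : nat) (U : set V)
    (f : V -> W) : Prop :=
  match k with
  | 0%N => forall x, U x -> {for x, continuous f}
  | k'.+1 => (forall x, U x -> differentiable f x) /\
             (forall v, Ck_on k' U (fun x => 'D_v f x))
  end.

Definition smooth_on (R : realType) (V W : normedModType R) (U : set V)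
    (f : V -> W) : Prop :=
  forall k, Ck_on k U f.

(* A chart carries total functions in both directions; they are meaningful only
   on [chart_dom] and [chart_cod] respectively. *)
Record chart (R : realType) (T : topologicalType) := Chart {
  chart_dom : set T;
  chart_cod : set 'rV[R]_2;
  chart_to : T -> 'rV[R]_2;
  chart_from : 'rV[R]_2 -> T }.

Definition is_chart (R : realType) (T : topologicalType) (c : chart R T) :
    Prop :=
  [/\ open (chart_dom c) /\ open (chart_cod c),
      forall p, chart_dom c p ->
        chart_cod c (chart_to c p) /\ chart_from c (chart_to c p) = p,
      forall x, chart_cod c x ->
        chart_dom c (chart_from c x) /\ chart_to c (chart_from c x) = x,
      forall p, chart_dom c p -> {for p, continuous (chart_to c)} &
      forall x, chart_cod c x -> {for x, continuous (chart_from c)}].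

(* A smooth atlas, presented with a preferred chart [ch p] around each point
   [p]. The tangent space at [p] is then identified with R^2 through [ch p]. *)
Definition smooth_atlas (R : realType) (T : topologicalType)
    (ch : T -> chart R T) : Prop :=
  [/\ forall p, is_chart (ch p),
      forall p, chart_dom (ch p) p &
      forall p q,
        smooth_on
          [set x | chart_cod (ch p) x /\
                   chart_dom (ch q) (chart_from (ch p) x)]
          (chart_to (ch q) \o chart_from (ch p))].

Definition connected_smooth_surface (R : realType) (T : topologicalType)
    (ch : T -> chart R T) : Prop :=
  [/\ smooth_atlas ch, hausdorff_space T, @second_countable T,
      connected [set: T] & [set: T] !=set0].

Definition plane_chart (R : realType) (q : 'rV[R]_2) : chart R 'rV[R]_2 :=
  Chart setT setT id id.

Definition smooth_map (R : realType) (T : topologicalType)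
    (ch : T -> chart R T) (W : normedModType R) (f : T -> W) : Prop :=
  forall p, smooth_on (chart_cod (ch p)) (f \o chart_from (ch p)).

Definition tangent_map (R : realType) (T : topologicalType)
    (ch : T -> chart R T) (W : normedModType R) (f : T -> W) (p : T)
    (v : 'rV[R]_2) : W :=
  'd (f \o chart_from (ch p)) (chart_to (ch p) p) v.

Definition immersion (R : realType) (T : topologicalType)
    (ch : T -> chart R T) (W : normedModType R) (f : T -> W) : Prop :=
  smooth_map ch f /\
  forall p v, tangent_map ch f p v = 0 -> v = 0.

(* A metric is given by its quadratic form: [g p v] is the square of the tangent
   vector with coordinates [v] in the preferred chart at [p]. *)
Definition riemannian (R : realType) (T : Type) (g : T -> 'rV[R]_2 -> R) :
    Prop :=
  forall p v, v != 0 -> 0 < g p v.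

Section Completeness.
Variables (R : realType) (T : topologicalType) (ch : T -> chart R T).
(* The surface under consideration is the open subset [X] of [T]. *)
Variables (X : set T) (g : T -> 'rV[R]_2 -> R).

Definition C1_at (gam : R -> T) (t : R) : Prop :=
  let f := chart_to (ch (gam t)) \o gam in
  [/\ {for t, continuous gam},
      \forall s \near t, derivable f s 1 &
      {for t, continuous (derive1 f)}].

Definition velocity (gam : R -> T) (t : R) : 'rV[R]_2 :=
  derive1 (chart_to (ch (gam t)) \o gam) t.

Definition curve_length (gam : R -> T) : \bar R :=
  \int[@lebesgue_measure R]_(t in `[0, 1])
    (Num.sqrt (g (gam t) (velocity gam t)))%:E.

Definition C1_curve (p q : T) (gam : R -> T) : Prop :=
  [/\ gam 0 = p, gam 1 = q &
      forall t, 0 <= t <= 1 -> X (gam t) /\ C1_at gam t].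

Definition riemannian_dist (p q : T) : \bar R :=
  ereal_inf [set curve_length gam | gam in C1_curve p q].

Definition complete_metric : Prop :=
  forall u : nat -> T,
    (forall n, X (u n)) ->
    (forall e : R, 0 < e -> exists N : nat, forall m n : nat,
        (N <= m)%N -> (N <= n)%N -> (riemannian_dist (u m) (u n) < e%:E)%E) ->
    exists2 p, X p &
      forall e : R, 0 < e -> exists N : nat, forall n : nat,
        (N <= n)%N -> (riemannian_dist (u n) p < e%:E)%E.

End Completeness.

Definition star_shaped (R : realType) (Omega : set 'rV[R]_2) : Prop :=
  Omega 0 /\
  forall (q : 'rV[R]_2) (t : R), Omega q -> 0 <= t <= 1 -> Omega (t *: q).

Section CalabiModel.
Variables (R : realType) (delta tau : 'rV[R]_2 -> R).

Definition xcoord (q : 'rV[R]_2) : R := q ord0 ord0.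
Definition ycoord (q : 'rV[R]_2) : R := q ord0 ord_max.

Definition calabi_potential (q : 'rV[R]_2) : R :=
  2 * \int[@lebesgue_measure R]_(t in `[0, 1])
        (t * (tau (t *: q) / delta (t *: q) ^+ 2)).

Definition conformal_metric (q v : 'rV[R]_2) : R :=
  (delta q ^+ 2)^-1 * (xcoord v ^+ 2 + ycoord v ^+ 2).

(* Points, and tangent vectors, of Omega x R: the first component is (x, y), the
   second one is z. *)
Definition lorentz_metric (P v : 'rV[R]_2 * R) : R :=
  (delta P.1 ^+ 2)^-1 * (xcoord v.1 ^+ 2 + ycoord v.1 ^+ 2)
  - (v.2 - calabi_potential P.1 *
           (ycoord P.1 * xcoord v.1 - xcoord P.1 * ycoord v.1)) ^+ 2.

Definition induced_metric (T : topologicalType) (ch : T -> chart R T)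
    (phi : T -> 'rV[R]_2 * R) (p : T) (v : 'rV[R]_2) : R :=
  lorentz_metric (phi p) (tangent_map ch phi p v).

Definition spacelike_immersion (Omega : set 'rV[R]_2) (T : topologicalType)
    (ch : T -> chart R T) (phi : T -> 'rV[R]_2 * R) : Prop :=
  [/\ forall p, Omega (phi p).1,
      immersion ch phi &
      riemannian (induced_metric ch phi)].

End CalabiModel.

(* The immersed surface [phi] is the graph of a function: its image is the graph
   and it does not cover the graph more than once. *)
Definition entire_graph (R : realType) (Omega : set 'rV[R]_2) (T : Type)
    (phi : T -> 'rV[R]_2 * R) : Prop :=
  injective phi /\
  exists u : 'rV[R]_2 -> R, range phi = [set (q, u q) | q in Omega].

(* Main.v *)
Require Import Defs.
From HB Require Import structures.
From mathcomp Require Import all_boot all_order all_algebra.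
From mathcomp Require Import all_classical all_reals all_analysis.
From mathcomp Require Import ring lra.
Import Order.TTheory GRing.Theory Num.Theory.
Import numFieldNormedType.Exports.
Local Open Scope classical_set_scope.
Local Open Scope ring_scope.

Set Implicit Arguments.
Unset Strict Implicit.
Unset Printing Implicit Defensive.

(** Since the Lorentzian metric is the metric of the base minus a square, the
    projection [F] of the surface to [Omega] does not decrease speeds from the
    surface to the base. Its differential is therefore injective, and the inverse
    function theorem makes [F] a local diffeomorphism, with the surface locally a
    graph over a disk. A curve of finite length in the base lifts as long as its
    lift does not leave every compact set, which completeness of the surface
    excludes. As [Omega] is star-shaped, only radial segments have to be lifted:
    sections of [F] over star-shaped open sets with a given value at the center
    agree where both are defined, so they have a union, and completeness shows
    that this union is defined on the whole of [Omega]. The image of the resulting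
    global section is open and closed, hence is the whole surface. Finally a Cauchy
    sequence of the base lifts to a Cauchy sequence of the surface, whose limit
    projects to a limit in the base. *)

(** Two comparisons of metrics are at work. Dropping the square bounds speeds on the surface by
    speeds in the base, so lifts of short curves are short. But completeness only gives convergence
    for [riemannian_dist], an infimum of lengths not known beforehand to control the topology of the
    surface, whereas continuing a section takes limits in that topology. The bridge is a reverse
    bound, local and with a constant: on the graph of [u] the metric is |w|^2 / delta^2 - <b, w>^2,
    where b is the gradient of [u] corrected by the Calabi potential. Its smaller eigenvalue
    delta^-2 - |b|^2 is positive because the surface is spacelike, and stays away from 0 near a
    point because it is continuous. A short enough curve ending at p therefore stays on the sheet of
    the surface through p. A second obstacle is that no point above the origin is given; this is why
    radial lifting is set up around an arbitrary center. *)

(* This join is needed by [banach_fixed_point]. *)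
HB.instance Definition _ (R : realType) (m n : nat) := Complete.on 'M[R]_(m, n).

(** * Differential calculus in row vectors *)

Section Calculus.
Context {R : realType}.

Lemma diff_eps (V W : normedModType R) (f : V -> W) (x : V) :
  differentiable f x -> forall e : R, 0 < e ->
  \forall y \near x, `|f y - f x - 'd f x (y - x)| <= e * `|y - x|.
Proof.
move=> /diff_locally fx e e0; have /eqaddoP/(_ e e0) := fx.
rewrite near_simpl (near_shift x 0) /=; apply: filterS => y.
by rewrite /= !fctE /= sub0r opprD addrA subrK.
Qed.

Lemma eps_diff (V W : normedModType R) (f : V -> W) (df : {linear V -> W})
    (x : V) :
  continuous df ->
  (forall e : R, 0 < e ->
    \forall y \near x, `|f y - f x - df (y - x)| <= e * `|y - x|) ->
  differentiable f x /\ 'd f x = df :> (V -> W).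
Proof.
move=> cdf H.
have E : f \o shift x = cst (f x) + df +o_ 0 id.
  apply/eqaddoP => e e0.
  rewrite near_simpl (near_shift x 0) /=; apply: filterS (H e e0) => y.
  by rewrite /= !fctE /= sub0r opprD addrA subrK.
have D := diff_unique cdf E.
by split => //; apply/diff_locallyP; rewrite D; split.
Qed.

Lemma near_norm_lt (V : normedModType R) (x : V) (e : R) :
  0 < e -> \forall y \near x, `|x - y| < e.
Proof. by move=> e0; apply/nbhs_normP; exists e. Qed.

Lemma entry_le_norm n (x : 'rV[R]_n) i : `|x 0 i| <= `|x|.
Proof.
rewrite [leRHS]/Num.Def.normr/= mx_normrE.
exact: (le_bigmax _ (fun ij : 'I_1 * 'I_n => `|x ij.1 ij.2|) (0, i)).
Qed.

Lemma norm_le_entries n (x : 'rV[R]_n) (e : R) :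
  0 <= e -> (forall i, `|x 0 i| <= e) -> `|x| <= e.
Proof.
move=> e0 h; rewrite [leLHS]/Num.Def.normr/= mx_normrE.
by apply: bigmax_le => // -[i j] _ /=; rewrite (ord1 i).
Qed.

Lemma linear_row_bound n (W : normedModType R) (f : {linear 'rV[R]_n -> W}) v :
  `|f v| <= (\sum_i `|f 'e_i|) * `|v|.
Proof.
rewrite {1}(row_sum_delta v) linear_sum (le_trans (ler_norm_sum _ _ _))//.
rewrite mulr_suml; apply: ler_sum => i _.
by rewrite linearZ normrZ mulrC ler_wpM2l// entry_le_norm.
Qed.

Lemma linear_row_continuous n (W : normedModType R)
    (f : {linear 'rV[R]_n -> W}) : continuous f.
Proof.
apply: bounded_linear_continuous; apply/linear_boundedP.
exists (\sum_i `|f 'e_i|); split; first exact: num_real.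
move=> r lr x; apply: le_trans (linear_row_bound f x) _.
by rewrite ler_wpM2r// ltW.
Qed.

Lemma diff_row_sum n (W : normedModType R) (f : 'rV[R]_n -> W) x v :
  differentiable f x -> 'd f x v = \sum_i v 0 i *: 'D_('e_i) f x.
Proof.
move=> fx; rewrite {1}(row_sum_delta v) linear_sum; apply: eq_bigr => i _.
by rewrite linearZ deriveE.
Qed.

Lemma cvg_big_sum {U : Type} {F : set_system U} {FF : Filter F}
    (V : normedModType R) n (f : 'I_n -> U -> V) (l : 'I_n -> V) :
  (forall i, f i t @[t --> F] --> l i) ->
  \sum_i f i t @[t --> F] --> \sum_i l i.
Proof.
elim: n f l => [|n ih] f l fl.
  rewrite big_ord0; under eq_fun do rewrite big_ord0; exact: cvg_cst.
rewrite big_ord_recr; under eq_fun do rewrite big_ord_recr.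
by apply: cvgD => //; apply: ih.
Qed.

Lemma Ck1P (V W : normedModType R) (A : set V) (f : V -> W) :
  Ck_on 1 A f <-> (forall x, A x -> differentiable f x) /\
    (forall v x, A x -> {for x, continuous (fun y => 'D_v f y)}).
Proof. by []. Qed.

(** In the standard basis the differential is a finite sum of entries of the vector times partial
    derivatives, so it is jointly continuous in base point and vector. The filter is arbitrary so
    that both may run along a curve or through a local inverse. *)
Lemma cvg_diff {U : Type} {F : set_system U} {FF : Filter F} n
    (W : normedModType R) (A : set 'rV[R]_n) (f : 'rV[R]_n -> W)
    (x : U -> 'rV[R]_n) (v : U -> 'rV[R]_n) (a w : 'rV[R]_n) :
  open A -> Ck_on 1 A f -> A a -> x t @[t --> F] --> a -> v t @[t --> F] --> w ->
  'd f (x t) (v t) @[t --> F] --> 'd f a w.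
Proof.
move=> oA /Ck1P[fA cA] Aa xa vw.
have E := diff_row_sum w (fA a Aa).
have : (\sum_i v t 0 i *: 'D_('e_i) f (x t)) @[t --> F] -->
    \sum_i w 0 i *: 'D_('e_i) f a.
  apply: cvg_big_sum => i; apply: cvgZ.
    exact: (continuous_cvg _ (@coord_continuous R 1 n 0 i w) vw).
  exact: (continuous_cvg _ (cA 'e_i a Aa) xa).
rewrite -E; apply: cvg_trans; apply: near_eq_cvg.
have : \forall t \near F, A (x t) by apply: xa; exact: open_nbhs_nbhs.
by apply: filterS => t /fA ft; rewrite (diff_row_sum (v t) ft).
Qed.

Lemma is_derive_diff_comp (V W : normedModType R) (f : V -> W) (g : R -> V)
    (dg : V) (t : R) :
  differentiable f (g t) -> is_derive t 1 g dg ->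
  is_derive t 1 (f \o g) ('d f (g t) dg).
Proof.
move=> df gt; have gd : differentiable g t by apply/derivable1_diffP.
apply: DeriveDef.
  by apply/derivable1_diffP; exact: differentiable_comp.
rewrite deriveE; last exact: differentiable_comp.
have E := diff_comp gd df.
have F : 'd g t 1 = dg by rewrite -deriveE//; exact: derive_val.
by rewrite E /= F.
Qed.

Lemma is_derive_coord n (F : R -> 'rV[R]_n) (D : 'rV[R]_n) (t : R) i :
  is_derive t 1 F D -> is_derive t 1 (fun s => F s 0 i) (D 0 i).
Proof.
move=> Ft; have dF : derivable F t 1 by [].
apply: DeriveDef; first exact: (derivable_mxP F t 1).1.
have := derive_mx dF; rewrite derive_val => ->.
by rewrite mxE.
Qed.

Lemma is_derive_line (V : normedModType R) (a v : V) (t : R) :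
  is_derive t 1 (fun s : R => a + s *: v) v.
Proof.
have dl : is_derive t 1 ( *:%R^~ v : R -> V) v.
  have dv : differentiable ( *:%R^~ v : R -> V) t.
    exact: (@ex_diff _ _ _ _ _ _ _ (is_diff_scalel _ _)).
  apply: DeriveDef; first exact/derivable1_diffP.
  by rewrite deriveE// diff_val scale1r.
have := is_deriveD (is_derive_cst a t 1) dl.
by rewrite add0r.
Qed.

(** The norm is the maximum of the entries, so the mean value theorem can be applied to one entry at
    a time, along the segment from [y] to [x]; this segment stays in the closed ball by
    convexity. *)
Lemma C1_lipschitz n m (A : set 'rV[R]_n) (f : 'rV[R]_n -> 'rV[R]_m)
    (x0 : 'rV[R]_n) (e : R) :
  open A -> Ck_on 1 A f -> A x0 -> (forall v, 'd f x0 v = 0) -> 0 < e ->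
  exists rho : R, [/\ 0 < rho, (forall x, `|x - x0| <= rho -> A x) &
    forall x y, `|x - x0| <= rho -> `|y - x0| <= rho ->
      `|f x - f y| <= e * `|x - y|].
Proof.
move=> oA /Ck1P[fA cA] Ax0 df0 e0.
(* The [n] partial derivatives together contribute at most [n * e' <= e]; the successor keeps [e']
   positive when [n = 0]. *)
pose e' := e / n.+1%:R.
have e'0 : 0 < e' by rewrite divr_gt0.
have : \forall x \near x0, A x /\ forall i : 'I_n, `|'D_('e_i) f x| <= e'.
  near=> x; split; first by near: x; exact: open_nbhs_nbhs.
  near: x; apply: filter_forall => i.
  have D0 : 'D_('e_i) f x0 = 0 by rewrite deriveE//; exact: fA.
  have /cvgrPdist_le/(_ e' e'0) := cA 'e_i x0 Ax0.
  by apply: filterS => x; rewrite D0 sub0r normrN.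
move=> /nbhs_normP[r r0 H].
have r20 : 0 < r / 2 by rewrite divr_gt0.
have rr : r / 2 < r by rewrite gtr_pMr// invf_lt1// ltr1n.
have HH (x : 'rV[R]_n) : `|x - x0| <= r / 2 ->
    A x /\ forall i : 'I_n, `|'D_('e_i) f x| <= e'.
  by move=> xr; apply: H; rewrite /= distrC (le_lt_trans xr).
exists (r / 2); split => // [x /HH[]//|x y xr yr].
have dE (z v : 'rV[R]_n) : `|z - x0| <= r / 2 -> `|'d f z v| <= e * `|v|.
  move=> /HH[Az Dz].
  have E := diff_row_sum v (fA _ Az).
  rewrite E (le_trans (ler_norm_sum _ _ _))//.
  apply: (@le_trans _ _ (\sum_(i < n) e' * `|v|)).
    apply: ler_sum => i _; rewrite normrZ [leRHS]mulrC.
    by apply: ler_pM => //; exact: entry_le_norm.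
  rewrite sumr_const card_ord -mulr_natl mulrA ler_wpM2r// /e' mulrCA.
  by rewrite ger_pMr// ler_pdivrMr// mul1r ler_nat.
apply: norm_le_entries => [|j]; first by rewrite mulr_ge0// ltW.
pose g (t : R) : R := f (y + t *: (x - y)) 0 j.
pose dg (t : R) : R := ('d f (y + t *: (x - y)) (x - y)) 0 j.
have seg (t : R) : 0 <= t <= 1 -> `|y + t *: (x - y) - x0| <= r / 2.
  move=> /andP[t0 t1].
  have -> : y + t *: (x - y) - x0 = (1 - t) *: (y - x0) + t *: (x - x0).
    by apply/rowP => k; rewrite !mxE; ring.
  rewrite (le_trans (ler_normD _ _))// !normrZ !ger0_norm ?subr_ge0//.
  have -> : r / 2 = (1 - t) * (r / 2) + t * (r / 2) by ring.
  by rewrite lerD// ler_wpM2l// subr_ge0.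
have gD (t : R) : 0 <= t <= 1 -> is_derive t 1 g (dg t).
  move=> /seg/HH[At _].
  exact: (is_derive_coord j (is_derive_diff_comp (fA _ At) (is_derive_line y (x - y) t))).
have [c c01] : exists2 c, c \in `[0, 1]%R & g 1 - g 0 = dg c * (1 - 0).
  apply: MVT_segment => [//|t|].
    by rewrite in_itv/= => /andP[t0 t1]; apply: gD; rewrite !ltW.
  by apply: derivable_within_continuous => t; rewrite in_itv/= => /gD[].
rewrite subr0 mulr1 /g scale1r scale0r addr0 subrKC => E.
rewrite !mxE E (le_trans (entry_le_norm _ _))//; apply: dE.
by apply: seg; move: c01; rewrite in_itv.
Unshelve. all: by end_near. Qed.

Lemma Ck1_comp n m (W : normedModType R) (A : set 'rV[R]_n) (B : set 'rV[R]_m)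
    (f : 'rV[R]_n -> W) (h : 'rV[R]_m -> 'rV[R]_n) :
  open A -> open B -> Ck_on 1 A f -> Ck_on 1 B h -> (forall y, B y -> A (h y)) ->
  Ck_on 1 B (f \o h) /\
  forall y v, B y -> 'd (f \o h) y v = 'd f (h y) ('d h y v).
Proof.
move=> oA oB cf /Ck1P[dh ch] BA; have [df cdf] := (Ck1P _ _).1 cf.
have dE y v : B y -> 'd (f \o h) y v = 'd f (h y) ('d h y v).
  move=> By.
  exact: (congr1 (fun F : 'rV[R]_m -> W => F v) (diff_comp (dh _ By) (df _ (BA _ By)))).
have dfh y : B y -> differentiable (f \o h) y.
  by move=> By; apply: differentiable_comp; [exact: dh|exact/df/BA].
split => //; apply/Ck1P; split => // v y By.
have E z : B z -> 'd f (h z) ('D_v h z) = 'D_v (f \o h) z.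
  move=> Bz; apply: etrans (congr1 ('d f (h z)) (deriveE v (dh _ Bz))) _.
  by apply: etrans (esym (dE _ _ Bz)) _; exact: esym (deriveE v (dfh _ Bz)).
have hy : h z @[z --> y] --> h y by exact/differentiable_continuous/dh.
have H : 'd f (h z) ('D_v h z) @[z --> y] --> 'd f (h y) ('D_v h y).
  exact: (cvg_diff oA cf (BA _ By) hy (ch v y By)).
rewrite /prop_for /continuous_at -(E _ By).
have N : \forall z \near y, 'd f (h z) ('D_v h z) = 'D_v (f \o h) z.
  have : \forall z \near y, B z by exact: open_nbhs_nbhs.
  by apply: filterS => z /E.
exact: (cvg_trans (near_eq_cvg N) H).
Qed.

Lemma Ck1_linear (V W W' : normedModType R) (A : set V) (f : V -> W)
    (L : {linear W -> W'}) :
  open A -> continuous L -> Ck_on 1 A f ->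
  Ck_on 1 A (L \o f) /\ forall x v, A x -> 'd (L \o f) x v = L ('d f x v).
Proof.
move=> oA cL /Ck1P[df cf].
have dL w : differentiable L w by exact: linear_differentiable.
have dE x v : A x -> 'd (L \o f) x v = L ('d f x v).
  move=> Ax.
  apply: etrans (congr1 (fun F : V -> W' => F v) (diff_comp (df _ Ax) (dL (f x)))) _.
  exact: (congr1 (fun F : W -> W' => F ('d f x v)) (diff_lin (f x) cL)).
have dLf x : A x -> differentiable (L \o f) x.
  by move=> Ax; apply: differentiable_comp; [exact: df|exact: dL].
split => //; apply/Ck1P; split => // v x Ax.
have E z : A z -> L ('D_v f z) = 'D_v (L \o f) z.
  move=> Az; apply: etrans (congr1 L (deriveE v (df _ Az))) _.
  by apply: etrans (esym (dE _ _ Az)) _; exact: esym (deriveE v (dLf _ Az)).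
rewrite /prop_for /continuous_at -(E _ Ax).
have H : L ('D_v f z) @[z --> x] --> L ('D_v f x).
  exact: (continuous_cvg _ (cL _) (cf v x Ax)).
have N : \forall z \near x, L ('D_v f z) = 'D_v (L \o f) z.
  have : \forall z \near x, A z by exact: open_nbhs_nbhs.
  by apply: filterS => z /E.
exact: (cvg_trans (near_eq_cvg N) H).
Qed.

(** Agreement of [f] with [Phi \o l] is required near [t] only: a curve is recovered from its
    coordinates only as long as it stays in the domain of the chart. *)
Lemma C1_curve_comp n (W : normedModType R) (A : set 'rV[R]_n)
    (Phi : 'rV[R]_n -> W) (l : R -> 'rV[R]_n) (f : R -> W) (t : R) :
  open A -> Ck_on 1 A Phi -> A (l t) -> {for t, continuous l} ->
  (\forall s \near t, derivable l s 1) -> {for t, continuous (derive1 l)} ->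
  (\forall s \near t, Phi (l s) = f s) ->
  [/\ is_derive t 1 f ('d Phi (l t) (derive1 l t)),
      \forall s \near t, derivable f s 1 & {for t, continuous (derive1 f)}].
Proof.
move=> oA cPhi Alt lc dl cl fE.
have [dPhi _] := (Ck1P _ _).1 cPhi.
have D : \forall s \near t,
    is_derive (s : R) 1 f ('d Phi (l s) (derive1 l s)).
  have fE' := nbhs_interior fE.
  have nA : \forall s \near t, A (l s) by apply: lc; exact: open_nbhs_nbhs.
  near=> s.
  have Es : \forall z \near s, Phi (l z) = f z by near: s.
  have As : A (l s) by near: s.
  have dls : derivable l s 1 by near: s.
  have il : is_derive (s : R) 1 l (derive1 l s).
    by rewrite derive1E; exact: derivableP.
  exact: near_eq_is_derive Es (is_derive_diff_comp (dPhi _ As) il).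
split.
- exact: nbhs_singleton D.
- by apply: filterS D => s [].
- have E (s : R) : is_derive (s : R) 1 f ('d Phi (l s) (derive1 l s)) ->
      'd Phi (l s) (derive1 l s) = derive1 f s.
    move=> Ds; exact: esym (etrans (derive1E f s) (@derive_val _ _ _ _ _ _ _ Ds)).
  have H : 'd Phi (l s) (derive1 l s) @[s --> t] --> 'd Phi (l t) (derive1 l t).
    exact: (cvg_diff oA cPhi Alt lc cl).
  rewrite /prop_for /continuous_at -(E t (nbhs_singleton D)).
  have N : \forall s \near t, 'd Phi (l s) (derive1 l s) = derive1 f s.
    by apply: filterS D => s Ds; exact: (E s Ds).
  exact: (cvg_trans (near_eq_cvg N) H).
Unshelve. all: by end_near. Qed.

Lemma fst_cont (V W : normedModType R) : continuous (fst : V * W -> V).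
Proof. by move=> x; exact: cvg_fst. Qed.

Lemma snd_cont (V W : normedModType R) : continuous (snd : V * W -> W).
Proof. by move=> x; exact: cvg_snd. Qed.

Lemma diff_row2 (u : 'rV[R]_2 -> R) y v : differentiable u y ->
  'd u y v = xcoord v * 'D_('e_ord0) u y + ycoord v * 'D_('e_ord_max) u y.
Proof.
move=> du; apply: etrans (diff_row_sum v du) _.
rewrite !big_ord_recr big_ord0 /= add0r.
by congr (_ *: _ + _ *: _); rewrite /xcoord ?/ycoord; congr (v _ _); apply/val_inj.
Qed.

(** Cauchy-Schwarz through Lagrange's identity: the two sides differ by (x w - y v)^2. The factor on
    the left is the eigenvalue of the form in the direction (x, y). *)
Lemma quadratic_form_ge (D x y v w : R) :
  (D - (x ^+ 2 + y ^+ 2)) * (v ^+ 2 + w ^+ 2) <=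
  D * (v ^+ 2 + w ^+ 2) - (x * v + y * w) ^+ 2.
Proof.
rewrite -subr_ge0.
have -> : D * (v ^+ 2 + w ^+ 2) - (x * v + y * w) ^+ 2 -
    (D - (x ^+ 2 + y ^+ 2)) * (v ^+ 2 + w ^+ 2) = (x * w - y * v) ^+ 2 by ring.
exact: sqr_ge0.
Qed.

Lemma norm_sq_le (v : 'rV[R]_2) : `|v| <= Num.sqrt (xcoord v ^+ 2 + ycoord v ^+ 2).
Proof.
apply: norm_le_entries => [|i]; first exact: sqrtr_ge0.
rewrite -sqrtr_sqr ler_wsqrtr//.
have [->|->] : i = ord0 \/ i = ord_max.
  by case: i => [[|[|//]] ?]; [left|right]; exact/val_inj.
  by rewrite /xcoord lerDl sqr_ge0.
by rewrite /ycoord lerDr sqr_ge0.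
Qed.

End Calculus.

(** * The inverse function theorem *)

Section InverseFunction.
Context {R : realType} {n : nat}.
Implicit Types (A U : set 'rV[R]_n) (G h : 'rV[R]_n -> 'rV[R]_n).

Lemma linear_row_bound_gt0 (W : normedModType R) (f : {linear 'rV[R]_n -> W}) :
  exists2 c : R, 0 < c & forall v, `|f v| <= c * `|v|.
Proof.
exists (1 + \sum_i `|f 'e_i|); first by rewrite ltr_pwDl// sumr_ge0.
move=> v; apply: le_trans (linear_row_bound f v) _.
by rewrite ler_wpM2r// lerDr.
Qed.

Lemma injective_linear_inverse (f : {linear 'rV[R]_n -> 'rV[R]_n}) :
  (forall v, f v = 0 -> v = 0) ->
  exists K : {linear 'rV[R]_n -> 'rV[R]_n}, cancel f K /\ cancel K f.
Proof.
move=> f0; have Ju : lin1_mx f \in unitmx.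
  rewrite -row_free_unit; apply: inj_row_free => v.
  by rewrite mul_rV_lin1 => /f0.
exists (mulmxr (invmx (lin1_mx f))); split => v /=.
  by rewrite -mul_rV_lin1 mulmxK.
by rewrite -mul_rV_lin1 mulmxKV.
Qed.

Lemma contraction_fixpoint (x0 : 'rV[R]_n) (rho : R)
    (T : 'rV[R]_n -> 'rV[R]_n) :
  0 <= rho ->
  (forall x, `|x - x0| <= rho -> `|T x - x0| <= rho) ->
  (forall x y, `|x - x0| <= rho -> `|y - x0| <= rho ->
    `|T x - T y| <= 2^-1 * `|x - y|) ->
  exists2 x, `|x - x0| <= rho & x = T x.
Proof.
move=> rho0 TB TL; pose B : set 'rV[R]_n := [set x | `|x - x0| <= rho].
have TBB : {homo T : x / B x >-> B x} by move=> x; exact: TB.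
have [F TF] := Pfun TBB.
have cF : is_contraction F.
  have q0 : (0 : R) <= 2^-1 by [].
  exists (NngNum q0); split => /=; first by rewrite invf_lt1// ltr1n.
  by move=> [x y] [/= Bx By]; rewrite -TF; exact: TL.
have csub : continuous (fun x : 'rV[R]_n => x - x0).
  by move=> x; apply: continuousB; [exact: cvg_id|exact: (@cst_continuous _ _ x0)].
have cB : closed B.
  have -> : B = (fun x => `|x - x0|) @^-1` [set t : R | t <= rho] by [].
  apply: preimage_closed => [x _|]; last exact: closed_le.
  by apply: continuous_comp (csub x) _; exact: norm_continuous.
have B0 : B !=set0 by exists x0; rewrite /B/= subrr normr0.
have [p Bp pF] := banach_fixed_point cF cB B0.
by exists p => //; rewrite TF.
Qed.

(** Simplified Newton method: with [K] the inverse of the differential at [x0], the map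
    [psi = id - K \o G] has zero differential there, hence is 1/2-Lipschitz on a ball, and the fixed
    points of [psi + K y] are the solutions of [G x = y]. The same estimate, read as |x - x'| <= |x
    - x'| / 2 + c |G x - G x'|, gives the last clause with [C = 2 * c]. *)
Lemma local_inverse A G (x0 : 'rV[R]_n) :
  open A -> Ck_on 1 A G -> A x0 -> (forall v, 'd G x0 v = 0 -> v = 0) ->
  exists h (r C : R) U,
   [/\ 0 < r /\ 0 < C, [/\ open U, U x0 & U `<=` A],
     (forall x, U x -> ball (G x0) r (G x) /\ h (G x) = x),
     (forall y, ball (G x0) r y -> U (h y) /\ G (h y) = y) &
     (forall x x', U x -> U x' -> `|x - x'| <= C * `|G x - G x'|)].
Proof.
move=> oA cG Ax0 dG0.
have [K [dGK KdG]] := injective_linear_inverse dG0.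
have [c c0 Kc] := linear_row_bound_gt0 K.
have cK : continuous K by exact: linear_row_continuous.
have [GA cGA] := (Ck1P _ _).1 cG.
pose psi : 'rV[R]_n -> 'rV[R]_n := id - (K \o G).
have psiE x : psi x = x - K (G x) by [].
have KG x : A x -> differentiable (K \o G) x.
  by move=> Ax; apply: differentiable_comp; [exact: GA|exact: linear_differentiable].
have dpsi x v : A x -> 'd psi x v = v - K ('d G x v).
  move=> Ax.
  have idx : differentiable (@id 'rV[R]_n) x by exact: ex_diff.
  have dK : differentiable K (G x) by exact: linear_differentiable.
  have E0 := congr1 (fun F : 'rV[R]_n -> 'rV[R]_n => F v) (diffB idx (KG _ Ax)).
  have E1 := congr1 (fun F : 'rV[R]_n -> 'rV[R]_n => F v) (diff_comp (GA _ Ax) dK).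
  have E2 := congr1 (fun F : 'rV[R]_n -> 'rV[R]_n => F ('d G x v)) (diff_lin (G x) cK).
  have E3 := congr1 (fun F : 'rV[R]_n -> 'rV[R]_n => F v) (@diff_val _ _ _ _ _ _ _ (is_diff_id x)).
  apply: etrans E0 _; congr (_ - _); first exact: E3.
  exact: etrans E1 E2.
have cpsi : Ck_on 1 A psi.
  apply/Ck1P; split => [x Ax|v x Ax].
    by apply: differentiableB; [exact: ex_diff|exact: KG].
  have E : \forall z \near x, v - K ('D_v G z) = 'D_v psi z.
    have : \forall z \near x, A z by exact: open_nbhs_nbhs.
    apply: filterS => z Az.
    have dz : differentiable psi z.
      by apply: differentiableB; [exact: ex_diff|exact: KG].
    apply: etrans (congr1 (fun w => v - K w) (deriveE v (GA z Az))) _.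
    exact: esym (etrans (deriveE v dz) (dpsi z v Az)).
  have := nbhs_singleton E => Ex.
  rewrite /prop_for /continuous_at -Ex; apply: cvg_trans (near_eq_cvg E) _.
  by apply: cvgB; [exact: cvg_cst|exact: (continuous_cvg _ (cK _) (cGA v x Ax))].
have [||rho [rho0 rhoA psiL]] := C1_lipschitz (e := 2^-1) oA cpsi Ax0.
- by move=> v; rewrite dpsi// dGK subrr.
- by rewrite invr_gt0.
have invL x y : `|x - x0| <= rho -> `|y - x0| <= rho ->
    `|x - y| <= 2 * c * `|G x - G y|.
  move=> xr yr; have := psiL x y xr yr.
  have -> : psi x - psi y = (x - y) - K (G x - G y).
    by rewrite (linearB K) !psiE; apply/rowP => i; rewrite !mxE; ring.
  have := Kc (G x - G y); have := lerB_dist (x - y) (K (G x - G y)).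
  move: (`|x - y|) (`|G x - G y|) (`|K _|) => a b k h1 h2 h3.
  by nra.
(* This makes [K (y - G x0)] shorter than [rho / 2], the room left by the 1/2-Lipschitz [psi]; as
   the inequality is strict, the fixed point lies in the open ball, as [U] demands. *)
pose r := rho / (4 * c).
have r0 : 0 < r by rewrite divr_gt0// mulr_gt0.
pose U : set 'rV[R]_n := [set x | ball x0 rho x /\ ball (G x0) r (G x)].
have Urho x : U x -> `|x - x0| <= rho.
  by move=> [+ _]; rewrite -ball_normE /= distrC => /ltW.
have Kry y : ball (G x0) r y -> `|K (y - G x0)| < rho / 2.
  rewrite -ball_normE /= distrC => yr; rewrite (le_lt_trans (Kc _))//.
  rewrite mulrC -ltr_pdivlMr// (lt_trans yr)// /r ltr_pdivlMr//.
  have -> : rho / (4 * c) * c = rho / 4 by field; rewrite gt_eqF.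
  by lra.
have ex y : ball (G x0) r y -> exists x, U x /\ G x = y.
  move=> yr; have [|||x xr xE] := @contraction_fixpoint x0 rho (fun x => psi x + K y).
  - exact: ltW.
  - move=> x xr; have -> : psi x + K y - x0 = (psi x - psi x0) + K (y - G x0).
      by rewrite (linearB K) !psiE; apply/rowP => i; rewrite !mxE; ring.
    rewrite (le_trans (ler_normD _ _))//.
    have h1 : `|psi x - psi x0| <= 2^-1 * `|x - x0|.
      by apply: psiL => //; rewrite subrr normr0 ltW.
    have := Kry y yr; lra.
  - by move=> x z xr zr; rewrite opprD addrACA subrr addr0; exact: psiL.
  have Gx : G x = y.
    apply: (can_inj KdG); apply/rowP => i.
    by have := congr1 (fun w : 'rV[R]_n => w 0 i) xE; rewrite psiE !mxE; lra.
  exists x; split=> //; split; last by rewrite Gx.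
  rewrite -ball_normE /= distrC.
  have h1 : `|psi x - psi x0| <= 2^-1 * `|x - x0|.
    by apply: psiL => //; rewrite subrr normr0 ltW.
  have h2 := Kry y yr.
  have h3 : `|x - x0| <= `|psi x - psi x0| + `|K (y - G x0)|.
    rewrite -{1}Gx (le_trans _ (ler_normD _ _))//.
    rewrite (linearB K) !psiE le_eqVlt; apply/orP; left; apply/eqP; congr (`| _ |).
    by rewrite Gx; apply/rowP => i; rewrite !mxE; ring.
  by lra.
exists (fun y => get (fun x => U x /\ G x = y)), r, (2 * c), U.
split.
- by split => //; rewrite mulr_gt0.
- split.
  + rewrite openE => x [xr Gxr]; rewrite /interior /=.
    have Ax : A x by apply/rhoA/Urho.
    have Gc : {for x, continuous G} by exact/differentiable_continuous/GA.
    near=> z; split; near: z.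
      exact: (open_nbhs_nbhs (conj (ball_open _ _) xr)).
    exact/Gc/(open_nbhs_nbhs (conj (ball_open _ _) Gxr)).
  + by split; exact: ballxx.
  + by move=> x /Urho; exact: rhoA.
- move=> x Ux; have Gxr := Ux.2; split => //.
  have [Ug gE] := getPex (ex _ Gxr).
  have := invL _ _ (Urho _ Ug) (Urho _ Ux).
  by rewrite gE subrr normr0 mulr0 normr_le0 subr_eq0 => /eqP.
- by move=> y /ex/getPex.
- by move=> x x' /Urho xr /Urho; exact: invL.
Unshelve. all: by end_near. Qed.

(** The lower bound on increments passes to the differential by testing it on a short multiple of
    [v]. An error of rate 1/(2C) absorbs half of the left-hand side, whence the factor 2. *)
Lemma diff_lower_bound U G (x : 'rV[R]_n) (C : R) :
  0 < C -> nbhs x U -> differentiable G x ->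
  (forall z, U z -> `|z - x| <= C * `|G z - G x|) ->
  forall v, `|v| <= 2 * C * `|'d G x v|.
Proof.
move=> C0 Ux dG UC v.
have [->|v0] := eqVneq v 0; first by rewrite normr0 mulr_ge0// mulr_ge0// ltW.
have nv : 0 < `|v| by rewrite normr_gt0.
have e0 : 0 < (2 * C)^-1 by rewrite invr_gt0 mulr_gt0.
have /nbhs_normP[d d0 H] : \forall z \near x, `|z - x| <= C * `|G z - G x| /\
    `|G z - G x - 'd G x (z - x)| <= (2 * C)^-1 * `|z - x|.
  by near=> z; split; near: z; [exact: filterS Ux|exact: (diff_eps dG e0)].
pose t := d / (2 * `|v|).
have t0 : 0 < t by rewrite divr_gt0// mulr_gt0.
have E : x + t *: v - x = t *: v by rewrite addrC addKr.
have [|h1 h2] := H (x + t *: v).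
  rewrite /= distrC E normrZ gtr0_norm// /t.
  have -> : d / (2 * `|v|) * `|v| = d / 2 by field; rewrite gt_eqF.
  by move: d0 => /=; lra.
move: h1 h2; rewrite E normrZ gtr0_norm//.
set a := G _ - _; set b := 'd G x (t *: v) => h1 h2.
have h3 : `|a| <= `|a - b| + `|b| by rewrite -{1}(subrK b a) ler_normD.
have h4 : C * `|a| <= C * ((2 * C)^-1 * (t * `|v|) + `|b|).
  rewrite (ler_wpM2l (ltW C0))//; apply: le_trans h3 _; by rewrite lerD2r.
have h5 : C * ((2 * C)^-1 * (t * `|v|) + `|b|) = t * `|v| / 2 + C * `|b|.
  by field; rewrite gt_eqF.
have h6 : `|b| = t * `|'d G x v| by rewrite /b linearZ normrZ gtr0_norm.
have : t * `|v| <= t * (2 * C * `|'d G x v|).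
  have -> : t * (2 * C * `|'d G x v|) = 2 * (C * `|b|) by rewrite h6; ring.
  by rewrite h5 in h4; have := le_trans h1 h4; move: (t * `|v|) (C * _) => p q; lra.
by rewrite ler_pM2l.
Unshelve. all: by end_near. Qed.

(** The Lipschitz bound makes ['d G (h y)] injective at every [y] of the ball, not only at the
    center. Its inverse is then the differential of [h], as the expansion of [G] at [h y] shows. *)
Theorem inverse_function A G (x0 : 'rV[R]_n) :
  open A -> Ck_on 1 A G -> A x0 -> (forall v, 'd G x0 v = 0 -> v = 0) ->
  exists h (r : R) U,
   [/\ 0 < r, [/\ open U, U x0 & U `<=` A],
     (forall x, U x -> ball (G x0) r (G x) /\ h (G x) = x),
     (forall y, ball (G x0) r y -> U (h y) /\ G (h y) = y) &
     Ck_on 1 (ball (G x0) r) h].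
Proof.
move=> oA cG Ax0 dG0.
have [h [r [C [U [[r0 C0] [oU Ux0 UA] hG Gh Clip]]]]] :=
  local_inverse oA cG Ax0 dG0.
exists h, r, U; split => //.
have [GA cGA] := (Ck1P _ _).1 cG.
set V := ball (G x0) r.
have nV y : V y -> nbhs y V.
  by move=> Vy; apply: (open_nbhs_nbhs (conj (ball_open _ _) Vy)).
have hL y y' : V y -> V y' -> `|h y - h y'| <= C * `|y - y'|.
  by move=> /Gh[Uy {2}<-] /Gh[Uy' {2}<-]; exact: Clip.
have hc y : V y -> {for y, continuous h}.
  move=> Vy; rewrite /prop_for /continuous_at.
  apply/(@cvgrPdist_lt _ _ _ (nbhs y)) => e e0; near_simpl; near=> z.
  apply: (@le_lt_trans _ _ (C * `|y - z|)).
    by apply: hL => //; near: z; exact: nV.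
  rewrite mulrC -ltr_pdivlMr//; near: z.
  exact: (near_norm_lt y (divr_gt0 e0 C0)).
have C20 : 0 < 2 * C by rewrite mulr_gt0.
have dlow y : V y -> forall v, `|v| <= 2 * C * `|'d G (h y) v|.
  move=> /Gh[Uy _]; apply: (@diff_lower_bound U) => //.
  - exact: open_nbhs_nbhs.
  - exact/GA/UA.
  - by move=> z Uz; exact: Clip.
have dh y : V y -> differentiable h y /\ forall v, 'd G (h y) ('d h y v) = v.
  move=> Vy; have [Uy Gy] := Gh _ Vy.
  have inj v : 'd G (h y) v = 0 -> v = 0.
    move=> dv; have := dlow _ Vy v.
    by rewrite dv normr0 mulr0 normr_le0 => /eqP.
  have [K [dGK KdG]] := injective_linear_inverse inj.
  have cK : continuous K by exact: linear_row_continuous.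
  have [] := @eps_diff _ _ _ h K y cK.
    move=> e e0.
    (* One factor [2 * C] bounds [K], the other factor [C] turns |h z - h y| into |z - y|. *)
    have e'0 : 0 < e / (2 * C * C) by rewrite divr_gt0// mulr_gt0.
    have D := diff_eps (GA _ (UA _ Uy)) e'0.
    have Dh := hc _ Vy _ D.
    near=> z.
    have Vz : V z by near: z; exact: nV.
    have [Uz Gz] := Gh _ Vz.
    have : `|G (h z) - G (h y) - 'd G (h y) (h z - h y)| <=
       e / (2 * C * C) * `|h z - h y| by near: z; exact: Dh.
    rewrite Gz Gy => h1.
    have -> : h z - h y - K (z - y) = - K (z - y - 'd G (h y) (h z - h y)).
      by rewrite (linearB K (z - y)) dGK opprB.
    rewrite normrN.
    have h2 := dlow _ Vy (K (z - y - 'd G (h y) (h z - h y))).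
    rewrite KdG in h2; apply: le_trans h2 _.
    apply: (@le_trans _ _ (2 * C * (e / (2 * C * C) * (C * `|z - y|)))).
      apply: (ler_wpM2l (ltW C20)); apply: le_trans h1 _.
      apply: ler_wpM2l; last exact: hL.
      by rewrite ltW.
    by rewrite le_eqVlt; apply/orP; left; apply/eqP; field; rewrite gt_eqF.
  move=> dhy E; split; first exact: dhy.
  move=> v.
  have Ev := congr1 (fun F : 'rV[R]_n -> 'rV[R]_n => F v) E.
  exact: etrans (congr1 ('d G (h y)) Ev) (KdG v).
apply/Ck1P; split => [y /dh[]//|v y Vy].
have [dhy Ey] := dh _ Vy; have [Uy Gy] := Gh _ Vy.
rewrite /prop_for /continuous_at.
apply/(@cvgrPdist_le _ _ _ (nbhs y)) => e e0.
(* ['D_v h z] is the solution of ['d G (h z) x = v]. By [dlow], its distance to ['D_v h y] is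
   controlled by the extent to which ['D_v h y] fails that equation, and this tends to 0. *)
have cG1 : 'd G (h z) ('D_v h y) @[z --> y] --> 'd G (h y) ('D_v h y).
  exact: (cvg_diff oA cG (UA _ Uy) (hc y Vy) (cvg_cst ('D_v h y))).
have /cvgrPdist_le/(_ (e / (2 * C))) := cG1.
rewrite divr_gt0// => /(_ isT) H.
have vE : 'd G (h y) ('D_v h y) = v by exact: etrans (congr1 ('d G (h y)) (deriveE v dhy)) (Ey v).
have H' : \forall z \near y, `|v - 'd G (h z) ('D_v h y)| <= e / (2 * C).
  exact: (eq_ind _ (fun w => \forall z \near y,
    `|w - 'd G (h z) ('D_v h y)| <= e / (2 * C)) H _ vE).
near=> z; have Vz : V z by near: z; exact: nV.
have [dhz Ez] := dh _ Vz.
apply: le_trans (dlow _ Vz _) _.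
rewrite mulrC -ler_pdivlMr// (linearB ('d G (h z))).
have zE : 'd G (h z) ('D_v h z) = v by exact: etrans (congr1 ('d G (h z)) (deriveE v dhz)) (Ez v).
have hz : `|v - 'd G (h z) ('D_v h y)| <= e / (2 * C) by near: z; exact: H'.
by rewrite distrC; exact: (eq_ind _ (fun w =>
  `|w - 'd G (h z) ('D_v h y)| <= e / (2 * C) ->
  `|'d G (h z) ('D_v h z) - 'd G (h z) ('D_v h y)| <= e / (2 * C)) id _ zE hz).
Unshelve. all: by end_near. Qed.

End InverseFunction.

(** * Integrals over the unit interval *)

Section Integrals.
Context {R : realType}.
Notation mu := (@lebesgue_measure R).

(** The integral of a nonnegative function is a supremum over the simple functions below it, hence
    monotone without any measurability. Lengths can thus be compared without proving that speeds are
    measurable. *)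
Lemma ge0_le_integral_subset d (T : measurableType d)
    (m : {measure set T -> \bar R}) (A B : set T) (f g : T -> \bar R) :
  A `<=` B -> (forall x, A x -> 0 <= f x)%E -> (forall x, B x -> 0 <= g x)%E ->
  (forall x, A x -> f x <= g x)%E ->
  (\int[m]_(x in A) f x <= \int[m]_(x in B) g x)%E.
Proof.
move=> AB f0 g0 fg; rewrite !ge0_integralE//.
apply: ereal_sup_le => _ [k kf <-]; exists k => //= x.
apply: le_trans (kf x) _; rewrite /patch; case: ifPn => [/set_mem Ax|_].
  by rewrite mem_set ?fg//; exact: AB.
by case: ifPn => // /set_mem /g0.
Qed.

(** The fundamental theorem of calculus writes the increment as the integral of the derivative.
    Since the comparison above takes nonnegative integrands, the derivative is first replaced by its
    positive part [Fp], which is still continuous and below [f]. *)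
Lemma integral_ge_increment (f F : R -> R) (a b : R) :
  0 <= a -> a <= b -> b <= 1 -> (forall t, 0 <= t <= 1 -> 0 <= f t) ->
  (forall t, a <= t <= b -> derivable F t 1 /\ {for t, continuous (derive1 F)}) ->
  (forall t, a <= t <= b -> derive1 F t <= f t) ->
  ((F b - F a)%:E <= \int[mu]_(t in `[0%R, 1%R]) (f t)%:E)%E.
Proof.
move=> a0 ab b1 f0 dF Ff.
have int0 : (0 <= \int[mu]_(t in `[0%R, 1%R]) (f t)%:E)%E.
  by apply: integral_ge0 => t; rewrite /= in_itv/= lee_fin; exact: f0.
move: ab; rewrite le_eqVlt => /predU1P[->|ab]; first by rewrite subrr.
have cF' : {within `[a, b], continuous (derive1 F)}.
  apply: continuous_in_subspaceT => t; rewrite inE/= in_itv/= => /dF[_].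
  exact.
have cF t : a <= t <= b -> {for t, continuous F}.
  by move=> /dF[dt _]; apply/differentiable_continuous/derivable1_diffP.
rewrite EFinB -(continuous_FTC2 ab cF'); last 2 first.
- split.
  + by move=> t /=; rewrite in_itv/= => /andP[at_ tb]; apply: (dF t _).1; rewrite !ltW.
  + by apply/cvg_at_right_filter/cF; rewrite lexx ltW.
  + by apply/cvg_at_left_filter/cF; rewrite lexx ltW.
- by [].
pose Fp := fun t => Num.max (derive1 F t) 0.
have cFp : {within `[a, b], continuous Fp}.
  by move=> t; apply: continuous_max; [exact: cF'|exact: cst_continuous].
apply: (@le_trans _ _ (\int[mu]_(t in `[a, b]) (Fp t)%:E)%E).
  apply: le_integral => //.
  - by apply: continuous_compact_integrable => //; exact: segment_compact.
  - by apply: continuous_compact_integrable => //; exact: segment_compact.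
  - by move=> t _; rewrite lee_fin /Fp le_max lexx.
apply: ge0_le_integral_subset.
- move=> t /=; rewrite !in_itv/= => /andP[at_ tb].
  by rewrite (le_trans a0)//= (le_trans tb).
- by move=> t _; rewrite lee_fin /Fp le_max lexx orbT.
- by move=> t; rewrite /= in_itv/= lee_fin; exact: f0.
- move=> t; rewrite /= in_itv/= lee_fin => tab; rewrite /Fp ge_max Ff//=.
  by apply: f0; move: tab => /andP[at_ tb]; rewrite (le_trans a0)//= (le_trans tb).
Qed.

Lemma integral_unit_le_cst (f : R -> R) (M : R) :
  (forall t, 0 <= t <= 1 -> 0 <= f t) -> (forall t, 0 <= t <= 1 -> f t <= M) ->
  (\int[mu]_(t in `[0%R, 1%R]) (f t)%:E <= M%:E)%E.
Proof.
move=> f0 fM.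
have M0 : 0 <= M by rewrite (le_trans (f0 0 _) (fM 0 _))// lexx ler01.
apply: (@le_trans _ _ (\int[mu]_(t in `[0%R, 1%R]) (cst M%:E t))%E).
  by apply: ge0_le_integral_subset => // t; rewrite /= in_itv/= lee_fin => t01;
     rewrite ?f0 ?fM.
rewrite integral_cst//= lebesgue_measure_itv/= lte01 sube0.
by rewrite mule1.
Qed.

Lemma param_integral_continuous (V : normedModType R) (A : set V) (k : V -> R)
    (q : V) :
  open A -> (forall x (t : R), A x -> 0 <= t <= 1 -> A (t *: x)) ->
  (forall x, A x -> {for x, continuous k}) -> A q ->
  {for q, continuous (fun q => \int[mu]_(t in `[0, 1]) (t * k (t *: q)))}.
Proof.
move=> oA sA ck Aq.
have joint (t : R) x : 0 <= t <= 1 -> A x ->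
    (z.1 * k (z.1 *: z.2)) @[z --> (t, x)] --> t * k (t *: x).
  move=> t01 Ax; apply: cvgM; first exact: cvg_fst.
  apply: continuous_cvg; first by apply: ck; exact: sA.
  by apply: cvgZ; [exact: cvg_fst|exact: cvg_snd].
have ct (t : R) x : 0 <= t <= 1 -> A x ->
    {for t, continuous (fun s : R => s * k (s *: x))}.
  move=> t01 Ax; have ps : (s, x) @[s --> t] --> (t, x).
    exact: (cvg_pair cvg_id (cvg_cst x)).
  exact: (cvg_comp _ _ ps (joint t x t01 Ax)).
have int x : A x -> mu.-integrable `[0, 1] (EFin \o (fun t => t * k (t *: x))).
  move=> Ax; apply: continuous_compact_integrable; first exact: segment_compact.
  apply: continuous_in_subspaceT => t; rewrite inE/= in_itv/= => t01.
  exact: ct.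
rewrite /prop_for /continuous_at; apply/(@cvgrPdist_le _ _ _ (nbhs q)) => e e0.
(* Compactness of the unit interval turns joint continuity into closeness of the integrands
   uniformly in [t]. *)
have /compact_near_coveringP tube := @segment_compact R 0 1.
have : \forall x \near q, forall t, 0 <= t <= 1 ->
    `|t * k (t *: q) - t * k (t *: x)| <= e.
  apply: filterS (tube V (nbhs q) (fun x t =>
    `|t * k (t *: q) - t * k (t *: x)| <= e) _ _).
    by move=> x Hx t t01; apply: Hx; rewrite /= in_itv.
  move=> t; rewrite /= in_itv/= => t01.
  have e20 : 0 < e / 2 by rewrite divr_gt0.
  have /cvgrPdist_le/(_ _ e20) [[U1 U2] [/= U1t U2q] J] := joint t q t01 Aq.
  exists (U1, U2); first by split.
  move=> [t' x] [/= U1t' U2x].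
  have J1 := J (t', q) (conj U1t' (nbhs_singleton U2q)).
  have J2 := J (t', x) (conj U1t' U2x).
  rewrite (le_trans (ler_distD (t * k (t *: q)) _ _))//.
  by rewrite (splitr e) lerD// distrC.
move=> H; near=> x.
have Ax : A x by near: x; exact: open_nbhs_nbhs.
have ix := int _ Ax; have iq := int _ Aq.
have iqx : mu.-integrable `[0, 1]
    (EFin \o (fun t => t * k (t *: q) - t * k (t *: x))).
  exact: (integrableB _ iq ix).
rewrite -RintegralB// (le_trans (le_normr_Rintegral _ iqx))//.
have -> : e = \int[mu]_(t in `[0, 1]) (cst e t).
  rewrite Rintegral_cst//= lebesgue_measure_itv/= lte01 sube0/=.
  by rewrite mulr1.
apply: le_Rintegral => //.
- exact: integrable_norm.
- by apply: continuous_compact_integrable; [exact: segment_compact|exact: cst_continuous].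
- move=> t; rewrite /= in_itv/= => t01.
  have Hx : forall t, 0 <= t <= 1 -> `|t * k (t *: q) - t * k (t *: x)| <= e.
    by near: x.
  exact: Hx.
Unshelve. all: by end_near. Qed.

End Integrals.

Lemma calabi_potential_continuous (R : realType) (Omega : set 'rV[R]_2)
    (delta tau : 'rV[R]_2 -> R) (q : 'rV[R]_2) :
  open Omega -> star_shaped Omega -> (forall x, Omega x -> 0 < delta x) ->
  (forall x, Omega x -> {for x, continuous delta}) ->
  (forall x, Omega x -> {for x, continuous tau}) -> Omega q ->
  {for q, continuous (calabi_potential delta tau)}.
Proof.
move=> oO sO d0 cd ct Oq.
have ck x : Omega x -> {for x, continuous (fun x => tau x / delta x ^+ 2)}.
  move=> Ox; have dn : delta x ^+ 2 != 0 by rewrite expf_neq0// gt_eqF// d0.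
  exact: (cvgM (ct _ Ox) (cvgV dn (cvgM (cd _ Ox) (cd _ Ox)))).
have h := param_integral_continuous oO sO.2 ck Oq.
rewrite /prop_for /continuous_at /calabi_potential.
exact: (@cvgM _ _ (nbhs q) _ (fun=> 2) _ _ _ (cvg_cst _) h).
Qed.

(** * Segments *)

Section Segments.
Context {R : realType}.

(** Connectedness of the unit interval as an induction principle, proved with the supremum of the
    [t] such that [P] holds on all of [0, t]. Every continuation along a curve or a ray below has
    this form. *)
Lemma unit_interval_induction (P : R -> Prop) : P 0 ->
  (forall t, 0 <= t <= 1 -> (forall s, 0 <= s <= t -> P s) ->
    \forall s \near t, 0 <= s <= 1 -> P s) ->
  (forall t, 0 < t <= 1 -> (forall s, 0 <= s < t -> P s) -> P t) ->
  forall t, 0 <= t <= 1 -> P t.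
Proof.
move=> P0 Popen Pclosed.
pose S : set R := [set t | 0 <= t <= 1 /\ forall s, 0 <= s <= t -> P s].
have S0 : S 0.
  by split; [rewrite lexx ler01|move=> s /le_anti <-].
have hS : has_sup S.
  by split; [exists 0|exists 1 => t [/andP[]]].
pose m := sup S.
have m0 : 0 <= m by exact: sup_upper_bound.
have m1 : m <= 1 by apply: ge_sup; [exists 0|move=> t [/andP[]]].
have ltm s : 0 <= s < m -> P s.
  move=> /andP[s0 /(sup_gt hS.1)[t [_ Pt] st]].
  by apply: Pt; rewrite s0 ltW.
have Pm : P m.
  move: m0; rewrite le_eqVlt => /predU1P[<-//|m_gt0].
  by apply: Pclosed => //; rewrite m_gt0.
have Sm : S m.
  split; first by rewrite m0.
  move=> s /andP[s0]; rewrite le_eqVlt => /predU1P[->//|sm].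
  by apply: ltm; rewrite s0.
have [m_lt1|m_ge1] := ltP m 1; last first.
  move=> t /andP[t0 t1]; apply: Sm.2; rewrite t0; exact: le_trans m_ge1.
have /nbhs_normP[e e0 He] := Popen m Sm.1 Sm.2.
pose m' := Num.min 1 (m + e / 2).
have mm' : m < m' by rewrite lt_min m_lt1 ltrDl divr_gt0.
have : m' <= m.
  apply: sup_upper_bound => //; split.
    by rewrite (le_trans m0 (ltW mm'))/= /m' ge_min lexx.
  move=> s /andP[s0 sm']; have [sm|ms] := leP s m; first by apply: Sm.2; rewrite s0.
  apply: He.
    move: sm'; rewrite /m' le_min => /andP[_ sm']; rewrite /= ltr0_norm; last lra.
    by move: e0 => /=; lra.
  by rewrite s0 (le_trans sm')// /m' ge_min lexx.
by rewrite leNgt mm'.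
Qed.

Definition segment_curve (a b : 'rV[R]_2) (t : R) := a + t *: (b - a).

Local Notation seg := segment_curve.

Lemma segment_curve_nest (a y : 'rV[R]_2) (l m : R) :
  seg a (seg a y l) m = seg a y (m * l).
Proof. by apply/rowP => i; rewrite /segment_curve !mxE; ring. Qed.

Lemma segment_curve_split (a y : 'rV[R]_2) (l m t : R) :
  seg (seg a y l) (seg a y m) t = seg a y (l + t * (m - l)).
Proof. by apply/rowP => i; rewrite /segment_curve !mxE; ring. Qed.

Lemma segment_curve0 (a y : 'rV[R]_2) : seg a y 0 = a.
Proof. by rewrite /segment_curve scale0r addr0. Qed.

Lemma segment_curve1 (a y : 'rV[R]_2) : seg a y 1 = y.
Proof. by rewrite /segment_curve scale1r addrC subrK. Qed.

Lemma segment_curve_continuous (a y : 'rV[R]_2) : continuous (seg a y).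
Proof.
move=> t; apply/differentiable_continuous/derivable1_diffP.
by case: (is_derive_line a (y - a) t).
Qed.

Lemma segment_curve_continuous_end (a : 'rV[R]_2) (t : R) :
  continuous (fun y => seg a y t).
Proof.
move=> y.
have h : (z - a) @[z --> y] --> y - a by exact: (cvgB cvg_id (cvg_cst a)).
exact: (cvgD (cvg_cst a) (cvgZ (cvg_cst t) h)).
Qed.

Lemma ball_segment (x a b : 'rV[R]_2) (r t : R) : 0 <= t <= 1 ->
  ball x r a -> ball x r b -> ball x r (seg a b t).
Proof.
move=> /andP[t0 t1]; rewrite -ball_normE /= => ar br.
have -> : x - seg a b t = (1 - t) *: (x - a) + t *: (x - b).
  by apply/rowP => i; rewrite /segment_curve !mxE; ring.
rewrite (le_lt_trans (ler_normD _ _))// !normrZ !ger0_norm ?subr_ge0//.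
move: (`|x - a|) (`|x - b|) ar br => u v ur vr.
move: t1; rewrite le_eqVlt => /predU1P[->|t1]; first by rewrite subrr mul0r add0r mul1r.
have h1 : 0 < (1 - t) * (r - u) by rewrite mulr_gt0// subr_gt0.
have h2 : 0 <= t * (r - v) by rewrite mulr_ge0// subr_ge0 ltW.
by nra.
Qed.

End Segments.

(** * Spacelike surfaces *)

Section SpacelikeSurface.
Context {R : realType} {T : topologicalType} (ch : T -> chart R T).
Hypothesis chP : forall p, is_chart (ch p).
Hypothesis chp : forall p, chart_dom (ch p) p.
Local Notation seg := (@segment_curve R).

Lemma C1_at_comp (W : normedModType R) (f : T -> W) (gam : R -> T) (t : R) :
  (forall p, Ck_on 1 (chart_cod (ch p)) (f \o chart_from (ch p))) ->
  C1_at ch gam t ->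
  [/\ is_derive t 1 (f \o gam)
        (tangent_map ch f (gam t) (velocity ch gam t)),
      \forall s \near t, derivable (f \o gam) s 1 &
      {for t, continuous (derive1 (f \o gam))}].
Proof.
move=> sf [cg dl cl].
have [[oD oC] toK fromK cto cfrom] := chP (gam t).
apply: C1_curve_comp oC (sf (gam t)) _ _ dl cl _.
- by have [] := toK _ (chp (gam t)).
- exact: (cvg_comp _ _ cg (cto _ (chp (gam t)))).
- have : \forall s \near t, chart_dom (ch (gam t)) (gam s).
    by apply: cg; apply: open_nbhs_nbhs; split => //; exact: chp.
  by apply: filterS => s Ds; rewrite /= (toK _ Ds).2.
Qed.

Lemma smooth_map_continuous (W : normedModType R) (f : T -> W) :
  smooth_map ch f -> continuous f.
Proof.
move=> sf p; have [[oD oC] toK fromK cto cfrom] := chP p.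
have [df _] := (Ck1P _ _).1 (sf p 1%N).
have [Cp fp] := toK _ (chp p).
have H : ((f \o chart_from (ch p)) \o chart_to (ch p)) q @[q --> p] -->
    (f \o chart_from (ch p)) (chart_to (ch p) p).
  exact: (cvg_comp _ _ (cto p (chp p)) (differentiable_continuous (df _ Cp))).
rewrite /= fp in H.
have N : \forall q \near p, ((f \o chart_from (ch p)) \o chart_to (ch p)) q = f q.
  have : \forall q \near p, chart_dom (ch p) q.
    by apply: open_nbhs_nbhs; split => //; exact: chp.
  by apply: filterS => q Dq; rewrite /= (toK _ Dq).2.
exact: (cvg_trans (near_eq_cvg N) H).
Qed.

Variables (Omega : set 'rV[R]_2) (delta tau : 'rV[R]_2 -> R).
Hypothesis Omega_open : open Omega.
Hypothesis delta_pos : forall q, Omega q -> 0 < delta q.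
Hypothesis delta_continuous : forall q, Omega q -> {for q, continuous delta}.
Let C := calabi_potential delta tau.
Hypothesis C_continuous : forall q, Omega q -> {for q, continuous C}.
Variable phi : T -> 'rV[R]_2 * R.
Hypothesis phiO : forall p, Omega (phi p).1.
Hypothesis phi_smooth : smooth_map ch phi.
Hypothesis phi_riem : riemannian (induced_metric delta tau ch phi).
Let g := induced_metric delta tau ch phi.
Let F p := (phi p).1.

Lemma F_continuous : continuous F.
Proof.
move=> p; have cp := smooth_map_continuous phi_smooth (x := p).
exact: (@continuous_comp _ _ _ phi fst p cp (@fst_cont _ _ _ (phi p))).
Qed.

(** A tangent vector with zero projection is vertical, and on vertical vectors the Lorentz form is
    minus a square. *)
Lemma diff_projection_injective p (v : 'rV[R]_2) :
  ('d (phi \o chart_from (ch p)) (chart_to (ch p) p) v).1 = 0 -> v = 0.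
Proof.
move=> v0; apply/eqP; apply: contraT => vn0.
have := phi_riem p vn0.
rewrite /induced_metric /lorentz_metric /tangent_map v0 /xcoord /ycoord !mxE.
by rewrite expr0n addr0 mulr0 sub0r oppr_gt0 ltNge sqr_ge0.
Qed.

(** The inverse function theorem is applied to the projection read in the chart at [p]; [h] is its
    inverse and [u] the height. The points [q] with [sigma (F q) = q] form the sheet through [p];
    since it is open, anything converging to a point of it is eventually described by the graph. *)
Lemma local_graph p : exists (r : R) (h : 'rV[R]_2 -> 'rV[R]_2),
  let sigma := chart_from (ch p) \o h in
  let u y := (phi (sigma y)).2 in
  [/\ 0 < r, (forall y, ball (F p) r y -> Omega y), Ck_on 1 (ball (F p) r) h,
    sigma (F p) = p /\
    (forall y, ball (F p) r y ->
      [/\ {for y, continuous sigma}, F (sigma y) = y,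
          chart_dom (ch p) (sigma y) & chart_to (ch p) (sigma y) = h y]) &
    [/\ open [set q | ball (F p) r (F q) /\ sigma (F q) = q],
      Ck_on 1 (ball (F p) r) u &
      forall w, w != 0 ->
        0 < lorentz_metric delta tau (phi p) (w, 'd u (F p) w)]].
Proof.
have [[oD oC] toK fromK cto cfrom] := chP p.
set Phi := phi \o chart_from (ch p); set x0 := chart_to (ch p) p.
have cPhi : Ck_on 1 (chart_cod (ch p)) Phi by exact: (phi_smooth p 1%N).
have [Cx0 fx0] : chart_cod (ch p) x0 /\ chart_from (ch p) x0 = p by exact/toK/chp.
have [cG dG] := Ck1_linear (L := fst) oC (@fst_cont _ _ _) cPhi.
have [cZ dZ] := Ck1_linear (L := snd) oC (@snd_cont _ _ _) cPhi.
set G := fst \o Phi in cG dG; set Z := snd \o Phi in cZ dZ.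
have dG0 v : 'd G x0 v = 0 -> v = 0.
  by move=> e; apply: (@diff_projection_injective p); apply: etrans e; apply/esym/dG.
have Gx0 : G x0 = F p by rewrite /G /Phi /= fx0.
have [h [r0 [U [r00 [oU Ux0 UA] hG Gh ch0]]]] := inverse_function oC cG Cx0 dG0.
rewrite Gx0 in hG Gh ch0.
have : \forall y \near F p, Omega y.
  by apply: open_nbhs_nbhs; split => //; exact: phiO.
move=> /nbhs_ballP[r1 r10 r1O].
pose r := Num.min r0 r1.
have rr0 y : ball (F p) r y -> ball (F p) r0 y.
  by apply: le_ball; rewrite /r ge_min lexx.
have r_gt0 : 0 < r by rewrite lt_min r00 r10.
have c_h : Ck_on 1 (ball (F p) r) h.
  have [a b] := (Ck1P _ _).1 ch0.
  by apply/Ck1P; split=> [y /rr0|v y /rr0]; [exact: a|exact: b].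
have oB : open (ball (F p) r) by exact: ball_open.
exists r, h => sigma u.
have hp : h (F p) = x0 by have [_] := hG _ Ux0; rewrite Gx0.
have hC y : ball (F p) r y -> chart_cod (ch p) (h y).
  by move=> /rr0/Gh[Uy _]; exact: UA.
have [cu du] := Ck1_comp oC oB cZ c_h hC.
have Bp : ball (F p) r (F p) by exact: ballxx.
split => //.
- by move=> y By; apply: r1O; apply: le_ball By; rewrite /r ge_min lexx orbT.
- split; first by rewrite /sigma /= hp.
  move=> y By; have [Uy Gy] := Gh _ (rr0 _ By).
  have [Dy Ty] := fromK _ (hC _ By).
  split => //.
  have hy : {for y, continuous h}.
    by apply: differentiable_continuous; exact: ((Ck1P _ _).1 c_h).1.
  exact: (cvg_comp _ _ hy (cfrom _ (hC _ By))).
- split.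
  + have -> : [set q | ball (F p) r (F q) /\ sigma (F q) = q] =
      [set q | ball (F p) r (F q) /\ (chart_dom (ch p) q /\ U (chart_to (ch p) q))].
      apply/seteqP; split => q /= [Bq].
        move=> sq; have [Uq Gq] := Gh _ (rr0 _ Bq).
        have [Dq Tq] := fromK _ (hC _ Bq).
        by split => //; rewrite -sq /sigma /= Tq.
      move=> [Dq Uq]; split => //; have [_ fq] := toK _ Dq.
      by have [_] := hG _ Uq; rewrite /G /Phi /= fq => hq; rewrite /sigma /= hq.
    rewrite openE => q /= [Bq [Dq Uq]].
    have n1 : \forall z \near q, ball (F p) r (F z).
      by apply: F_continuous; exact: open_nbhs_nbhs.
    have n2 : \forall z \near q, chart_dom (ch p) z by exact: open_nbhs_nbhs.
    have n3 : \forall z \near q, U (chart_to (ch p) z).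
      by apply: (cto q Dq); exact: open_nbhs_nbhs.
    by apply: filterS3 n1 n2 n3.
  + exact: cu.
  (* The vector [v] lifts [w] to the surface: its horizontal part is [w] because [G \o h] is the
     identity near [F p]. *)
  + move=> w wn0; pose v := 'd h (F p) w.
    have E1 : ('d Phi x0 v).1 = w.
      have [cGh dGh] := Ck1_comp oC oB cG c_h hC.
      apply: etrans (esym (dG _ _ Cx0)) _; rewrite -hp.
      apply: etrans (esym (dGh _ _ Bp)) _.
      have dd : differentiable (G \o h) (F p) by exact: ((Ck1P _ _).1 cGh).1.
      apply: etrans (esym (deriveE w dd)) _.
      apply: etrans (derive_id (F p) w).
      apply: near_eq_derive.
      have : \forall y \near F p, ball (F p) r y by exact: open_nbhs_nbhs.
      by apply: filterS => y /rr0/Gh[].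
    have E2 : ('d Phi x0 v).2 = 'd u (F p) w.
      apply: etrans (esym (dZ _ _ Cx0)) _; rewrite -hp.
      exact: esym (du _ _ Bp).
    have vn0 : v != 0.
      apply: contraNN wn0 => /eqP v0; apply/eqP; apply: etrans (esym E1) _.
      by rewrite v0 linear0.
    have e : 'd Phi x0 v = (w, 'd u (F p) w) by exact: injective_projections.
    exact: (eq_ind _ (fun z => 0 < lorentz_metric delta tau (phi p) z)
      (phi_riem p vn0) _ e).
Qed.

(** * Sections of the projection and lifts of curves *)

Definition section_on (s : 'rV[R]_2 -> T) (V : set 'rV[R]_2) :=
  forall y, V y -> {for y, continuous s} /\ F (s y) = y.

Lemma projection_curve (gam : R -> T) (t : R) : C1_at ch gam t ->
  [/\ {for t, continuous (F \o gam)},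
      \forall s \near t, derivable (F \o gam) s 1,
      {for t, continuous (derive1 (F \o gam))} &
      (tangent_map ch phi (gam t) (velocity ch gam t)).1 = derive1 (F \o gam) t].
Proof.
move=> c1; have oC p : open (chart_cod (ch p)) by have [[]] := chP p.
have cf p := Ck1_linear (L := fst) (oC p) (@fst_cont _ _ _) (phi_smooth p 1%N).
have cF p : Ck_on 1 (chart_cod (ch p)) (F \o chart_from (ch p)).
  exact: (cf p).1.
have [D dD cD] := C1_at_comp cF c1.
split; [|exact: dD|exact: cD|].
  by apply/differentiable_continuous/derivable1_diffP; case: D.
have Cp : chart_cod (ch (gam t)) (chart_to (ch (gam t)) (gam t)).
  by have [_ toK _ _ _] := chP (gam t); have [] := toK _ (chp (gam t)).
apply: etrans (esym ((cf (gam t)).2 _ _ Cp)) _.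
exact: esym (etrans (derive1E _ _) (@derive_val _ _ _ _ _ _ _ D)).
Qed.

Lemma speed_le_conformal (V : set 'rV[R]_2) (s : 'rV[R]_2 -> T)
    (alpha : R -> 'rV[R]_2) (t : R) :
  open V -> section_on s V -> V (alpha t) -> {for t, continuous alpha} ->
  C1_at ch (s \o alpha) t ->
  Num.sqrt (g (s (alpha t)) (velocity ch (s \o alpha) t)) <=
  Num.sqrt (conformal_metric delta (alpha t) (derive1 alpha t)).
Proof.
move=> oV sV Va ca c1; rewrite ler_wsqrtr//.
have [_ _ _ E] := projection_curve c1.
have E' : derive1 (F \o (s \o alpha)) t = derive1 alpha t.
  rewrite !derive1E; apply: near_eq_derive.
  have : \forall z \near t, V (alpha z).
    by apply: ca; exact: open_nbhs_nbhs.
  by apply: filterS => z /sV[].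
rewrite /g /induced_metric /lorentz_metric /conformal_metric.
rewrite [(phi (s (alpha t))).1](sV _ Va).2.
have E2 := etrans E E'; rewrite /= in E2 *; rewrite E2.
by rewrite lerBlDr lerDl sqr_ge0.
Qed.

(** Sections are only assumed continuous, but near [t] the lift stays on the sheet through its point
    [p], where its coordinates in the chart at [p] are [h \o alpha] with [h] of class C^1. *)
Lemma lift_C1 (V : set 'rV[R]_2) (s : 'rV[R]_2 -> T) (alpha : R -> 'rV[R]_2) (t : R) :
  open V -> section_on s V -> V (alpha t) -> C1_at (@plane_chart R) alpha t ->
  C1_at ch (s \o alpha) t.
Proof.
move=> oV sV Va [ca da cda].
have [sc Fs] := sV _ Va; set p := s (alpha t) in Fs.
have [r [h [r0 _ ch1 [sp hs] [oN _ _]]]] :=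
  local_graph p.
set sigma := chart_from (ch p) \o h in sp hs oN.
have Fp : F p = alpha t by [].
rewrite Fp in sp hs oN ch1.
set N := [set q | _] in oN.
have cs : {for t, continuous (s \o alpha)} by exact: (cvg_comp _ _ ca sc).
have Np : N p by rewrite /N /= Fp; split => //; exact: ballxx.
have nN : \forall z \near t, N (s (alpha z)).
  by apply: cs; exact: open_nbhs_nbhs.
have nV : \forall z \near t, V (alpha z).
  by apply: ca; exact: open_nbhs_nbhs.
have hE : \forall z \near t, h (alpha z) = (chart_to (ch p) \o (s \o alpha)) z.
  near=> z.
  have Vz : V (alpha z) by near: z.
  have [Bz Ez] : N (s (alpha z)) by near: z.
  rewrite (sV _ Vz).2 in Bz Ez.
  by have [_ _ _] := hs _ Bz; rewrite Ez /= => ->.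
have [||D dD cD] := C1_curve_comp _ ch1 _ ca da cda hE.
- exact: ball_open.
- exact: ballxx.
by split.
Unshelve. all: by end_near. Qed.

(** The last clause is the reverse of [speed_le_conformal], up to a constant and on one sheet: a
    short curve on the surface has a short projection. *)
Lemma local_section p : exists (r c : R) (sigma : 'rV[R]_2 -> T),
  let B := ball (F p) r in
  let N := [set q | B (F q) /\ sigma (F q) = q] in
  [/\ 0 < r /\ 0 < c, B `<=` Omega, section_on sigma B /\ sigma (F p) = p,
     open N &
     forall gam t, C1_at ch gam t -> N (gam t) ->
       c * `|derive1 (F \o gam) t| <= Num.sqrt (g (gam t) (velocity ch gam t))].
Proof.
have [r0 [h [r00 BO ch1 [sp hs] [oN cu pos]]]] :=
  local_graph p.
set sigma := chart_from (ch p) \o h in sp hs oN cu pos.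
set u := (fun y => (phi (sigma y)).2) in cu pos.
set y0 := F p in BO ch1 sp hs oN cu pos.
pose b0 y := 'D_('e_ord0) u y - C y * ycoord y.
pose b1 y := 'D_('e_ord_max) u y + C y * xcoord y.
pose kappa y := (delta y ^+ 2)^-1 - (b0 y ^+ 2 + b1 y ^+ 2).
have [du cdu] := (Ck1P _ _).1 cu.
(* On the graph of [u] the Lorentz form is [|w|^2 / delta^2 - <b, w>^2] with
   [b := (b0, b1)]. Testing it on [w := b] shows [kappa y0 > 0], and [kappa] is
   continuous. *)
have lE y z w : ball y0 r0 y -> lorentz_metric delta tau (y, z) (w, 'd u y w) =
    (delta y ^+ 2)^-1 * (xcoord w ^+ 2 + ycoord w ^+ 2) -
    (b0 y * xcoord w + b1 y * ycoord w) ^+ 2.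
  move=> By; rewrite /lorentz_metric /=; congr (_ - _ ^+ 2).
  rewrite -/(C y) /b0 /b1; apply: etrans (congr1 (fun d => d - _) (diff_row2 w (du _ By))) _.
  by ring.
have By0 : ball y0 r0 y0 by exact: ballxx.
have Oy0 : Omega y0 by exact: phiO.
have kappa_gt0 : 0 < kappa y0.
  pose w : 'rV[R]_2 := \row_i (if i == ord0 then b0 y0 else b1 y0).
  have w0 : xcoord w = b0 y0 by rewrite /xcoord mxE.
  have w1 : ycoord w = b1 y0 by rewrite /ycoord mxE.
  (* If b vanishes it cannot serve as a test vector, but then [kappa y0] is just delta^-2. *)
  have [wz|wn] := eqVneq w 0.
    rewrite /kappa -w0 -w1 wz /xcoord /ycoord !mxE expr0n addr0 subr0.
    by rewrite invr_gt0 exprn_gt0// delta_pos.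
  have := pos _ wn.
  have -> : phi p = (y0, (phi p).2) by exact: surjective_pairing.
  rewrite lE// w0 w1 /kappa.
  move: (delta y0 ^+ 2)^-1 (b0 y0) (b1 y0) => D x y.
  have -> : D * (x ^+ 2 + y ^+ 2) - (x * x + y * y) ^+ 2 =
    (D - (x ^+ 2 + y ^+ 2)) * (x ^+ 2 + y ^+ 2) by ring.
  rewrite mulrC; have := addr_ge0 (sqr_ge0 x) (sqr_ge0 y).
  by rewrite le_eqVlt => /predU1P[<-|/pmulr_rgt0 ->//]; rewrite mul0r ltxx.
have ckappa : {for y0, continuous kappa}.
  have c0 := cdu 'e_ord0 _ By0; have c1 := cdu 'e_ord_max _ By0.
  have cC := C_continuous Oy0; have cd := delta_continuous Oy0.
  have cx : {for y0, continuous (@xcoord R)} by exact: coord_continuous.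
  have cy : {for y0, continuous (@ycoord R)} by exact: coord_continuous.
  have d0 : delta y0 ^+ 2 != 0 by rewrite expf_neq0// gt_eqF// delta_pos.
  have cD : (delta y ^+ 2)^-1 @[y --> y0] --> (delta y0 ^+ 2)^-1.
    exact: (cvgV d0 (cvgM cd cd)).
  have cb0 : b0 y @[y --> y0] --> b0 y0 by exact: (cvgB c0 (cvgM cC cy)).
  have cb1 : b1 y @[y --> y0] --> b1 y0 by exact: (cvgD c1 (cvgM cC cx)).
  exact: (cvgB cD (cvgD (cvgM cb0 cb0) (cvgM cb1 cb1))).
have k2 : 0 < kappa y0 / 2 by rewrite divr_gt0.
have : \forall y \near y0, kappa y0 / 2 <= kappa y.
  have /cvgrPdist_le/(_ _ k2) := ckappa.
  by apply: filterS => y; rewrite ler_distl => /andP[_]; lra.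
move=> /nbhs_ballP[r1 r10 Hr1].
pose r := Num.min r0 r1.
have rr0 y : ball y0 r y -> ball y0 r0 y by apply: le_ball; rewrite /r ge_min lexx.
have rr1 y : ball y0 r y -> ball y0 r1 y.
  by apply: le_ball; rewrite /r ge_min lexx orbT.
exists r, (Num.sqrt (kappa y0 / 2)), sigma => B N.
split.
- by rewrite sqrtr_gt0 k2 lt_min r00 r10.
- by move=> y /rr0/BO.
- by split=> // y /rr0/hs[].
- have -> : N = [set q | ball y0 r0 (F q) /\ sigma (F q) = q] `&` (F @^-1` B).
    apply/seteqP; split => q /=; first
      by move=> [Bq sq]; split; [split; [exact: rr0|exact: sq]|exact: Bq].
    by move=> [[_ sq] Bq].
  apply: openI oN _; apply: open_comp (ball_open _ _) => q _.
  exact: (F_continuous).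
- move=> gam t c1 [Bt Nt]; have [cF dF _ vF] := projection_curve c1.
  rewrite /g /induced_metric.
  set v := tangent_map _ _ _ _ in vF *.
  (* On the sheet the height of the curve is [u] of its projection, so the vertical component of the
     velocity is determined by the horizontal one. *)
  have v2 : v.2 = 'd u (F (gam t)) v.1.
    have [Dphi _ _] := C1_at_comp (fun p => phi_smooth p 1%N) c1.
    have i1 : is_derive t 1 (F \o gam) v.1.
      by rewrite vF derive1E; apply: derivableP; exact: nbhs_singleton dF.
    have i2 := is_derive_diff_comp (du _ (rr0 _ Bt)) i1.
    have i3 : is_derive t 1 (snd \o (phi \o gam)) v.2.
      have dsnd : differentiable snd (phi (gam t)).
        by apply: linear_differentiable; exact: snd_cont.
      have e : 'd snd (phi (gam t)) v = v.2 :> R.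
        exact: (congr1 (fun f : 'rV[R]_2 * R -> R => f v)
          (diff_lin (phi (gam t)) (@snd_cont _ _ _))).
      have D2 := is_derive_diff_comp dsnd Dphi.
      exact: (eq_ind _ (fun z => is_derive t 1 (snd \o (phi \o gam)) z) D2 _ e).
    apply: etrans (esym (@derive_val _ _ _ _ _ _ _ i3)) _.
    apply: etrans (@derive_val _ _ _ _ _ _ _ i2).
    apply: near_eq_derive.
    have nN : \forall z \near t, [set q | ball y0 r0 (F q) /\ sigma (F q) = q] (gam z).
      have [cg _ _] := c1.
      by apply: cg; apply: open_nbhs_nbhs; split => //; split => //; exact: rr0.
    by apply: filterS nN => z /= [_ e]; rewrite /u e.
  have -> : phi (gam t) = (F (gam t), (phi (gam t)).2) by exact: surjective_pairing.
  have -> : v = (v.1, 'd u (F (gam t)) v.1) by rewrite -v2; exact: surjective_pairing.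
  rewrite lE; last exact: rr0.
  rewrite -vF; move: v.1 => w.
  apply: (@le_trans _ _ (Num.sqrt (kappa y0 / 2 * (xcoord w ^+ 2 + ycoord w ^+ 2)))).
    rewrite [leRHS]sqrtrM; last exact: ltW.
    by apply: ler_wpM2l; [exact: sqrtr_ge0|exact: norm_sq_le].
  rewrite ler_wsqrtr//; apply: le_trans (quadratic_form_ge _ _ _ _ _).
  rewrite ler_wpM2r ?addr_ge0 ?sqr_ge0//.
  by apply: Hr1; exact: rr1.
Qed.

(** * Lengths, distances and uniqueness of lifts *)

Hypothesis T_hausdorff : hausdorff_space T.
Let dist := riemannian_dist ch [set: T] g.

Lemma dist_lift_le_length (V : set 'rV[R]_2) (s : 'rV[R]_2 -> T)
    (alpha : R -> 'rV[R]_2) (a b : 'rV[R]_2) :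
  open V -> section_on s V -> C1_curve (@plane_chart R) V a b alpha ->
  (dist (s a) (s b) <=
   curve_length (@plane_chart R) (conformal_metric delta) alpha)%E.
Proof.
move=> oV sV [a0 a1 aC].
have cl t : 0 <= t <= 1 -> C1_at ch (s \o alpha) t.
  move=> /aC[Vt c1].
  exact: (lift_C1 oV sV Vt c1).
apply: (@le_trans _ _ (curve_length ch g (s \o alpha))).
  apply: ereal_inf_lbound; exists (s \o alpha); last by [].
  by split => [||t t01]; [rewrite /= a0|rewrite /= a1|split; [|exact: cl]].
apply: ge0_le_integral_subset.
- by [].
- by move=> t _; rewrite lee_fin; exact: sqrtr_ge0.
- by move=> t _; rewrite lee_fin; exact: sqrtr_ge0.
- move=> t; rewrite /= in_itv/= lee_fin => t01.
  have [Vt [ca _ _]] := aC _ t01.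
  exact: (speed_le_conformal oV sV Vt ca (cl _ t01)).
Qed.

(** The norm of ['rV_2] is the maximum norm, so the Euclidean norm is at most sqrt 2 times it; 2 is
    a convenient upper bound. *)
Lemma conformal_speed_le (y v : 'rV[R]_2) : 0 < delta y ->
  Num.sqrt (conformal_metric delta y v) <= (delta y)^-1 * (2 * `|v|).
Proof.
move=> d0; have i0 : 0 <= (delta y)^-1 by rewrite invr_ge0 ltW.
have h : 0 <= (delta y)^-1 * (2 * `|v|) by rewrite !mulr_ge0.
rewrite -(ger0_norm h) -sqrtr_sqr ler_wsqrtr// /conformal_metric.
rewrite exprMn exprVn ler_wpM2l//; first by rewrite invr_ge0 sqr_ge0.
have v0 : xcoord v ^+ 2 <= `|v| ^+ 2.
  by rewrite -[leLHS]real_normK ?num_real// lerXn2r ?nnegrE// entry_le_norm.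
have v1 : ycoord v ^+ 2 <= `|v| ^+ 2.
  by rewrite -[leLHS]real_normK ?num_real// lerXn2r ?nnegrE// entry_le_norm.
by rewrite exprMn; nra.
Qed.

Lemma segment_C1 (V : set 'rV[R]_2) (a b : 'rV[R]_2) :
  (forall t, 0 <= t <= 1 -> V (segment_curve a b t)) ->
  C1_curve (@plane_chart R) V a b (segment_curve a b).
Proof.
move=> sV; split => [||t t01].
- by rewrite /segment_curve scale0r addr0.
- by rewrite /segment_curve scale1r addrC subrK.
have D s := is_derive_line a (b - a) s.
split; first exact: sV.
split.
- by apply/differentiable_continuous/derivable1_diffP; case: (D t).
- by apply: (@nearW _ (nbhs t)) => s; case: (D s).
- have -> : derive1 (chart_to (@plane_chart R (segment_curve a b t)) \o
      segment_curve a b) = cst (b - a).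
    by apply/funext => s; exact: etrans (derive1E _ _) (@derive_val _ _ _ _ _ _ _ (D s)).
  exact: cst_continuous.
Qed.

Lemma segment_length_le (a b : 'rV[R]_2) (M : R) :
  (forall t, 0 <= t <= 1 -> 0 < delta (segment_curve a b t) /\
    (delta (segment_curve a b t))^-1 <= M) ->
  (curve_length (@plane_chart R) (conformal_metric delta) (segment_curve a b) <=
   (M * (2 * `|b - a|))%:E)%E.
Proof.
move=> H; apply: integral_unit_le_cst => t t01; first exact: sqrtr_ge0.
have [d0 dM] := H t t01.
have -> : velocity (@plane_chart R) (segment_curve a b) t = b - a.
  exact: etrans (derive1E _ _) (@derive_val _ _ _ _ _ _ _ (is_derive_line a (b - a) t)).
apply: le_trans (conformal_speed_le _ d0) _.
by rewrite ler_wpM2r// mulr_ge0.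
Qed.

(** For the maximum norm it is enough to bound each coordinate with either sign, which is why [k]
    below is [c] or [- c]. The interval ends at 1 because curves will be followed backwards from
    their end point. *)
Lemma displacement_le_length (gam : R -> T) (a c : R) :
  0 <= a <= 1 -> 0 < c -> (forall t, 0 <= t <= 1 -> C1_at ch gam t) ->
  (forall t, a <= t <= 1 ->
    c * `|derive1 (F \o gam) t| <= Num.sqrt (g (gam t) (velocity ch gam t))) ->
  ((c * `|F (gam 1) - F (gam a)|)%:E <= curve_length ch g gam)%E.
Proof.
move=> /andP[a0 a1] c0 c1 cs.
have PC t : a <= t <= 1 -> [/\ {for t, continuous (F \o gam)},
    \forall s \near t, derivable (F \o gam) s 1 &
    {for t, continuous (derive1 (F \o gam))}].
  move=> /andP[at_ t1]; have t01 : 0 <= t <= 1 by rewrite (le_trans a0)//= t1.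
  by have [] := projection_curve (c1 t t01).
have coord (k : R) (i : 'I_2) : `|k| = c ->
    ((k * (F (gam 1) - F (gam a)) 0 i)%:E <= curve_length ch g gam)%E.
  move=> kc.
  pose G t : R := k *: ((F \o gam) t 0 i).
  have DG (t : R) : derivable (F \o gam) t 1 ->
      is_derive t 1 G (k *: (derive1 (F \o gam) t 0 i)).
    move=> dt; apply: is_deriveZ; apply: is_derive_coord.
    by rewrite derive1E; exact: derivableP.
  have dGE (t : R) : derivable (F \o gam) t 1 ->
      k *: (derive1 (F \o gam) t 0 i) = derive1 G t.
    by move=> /DG D; exact: esym (etrans (derive1E G t) (@derive_val _ _ _ _ _ _ _ D)).
  have -> : k * (F (gam 1) - F (gam a)) 0 i = G 1 - G a.
    by rewrite !mxE mulrBr.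
  apply: integral_ge_increment.
  - exact: a0.
  - exact: a1.
  - exact: lexx.
  - by move=> t _; exact: sqrtr_ge0.
  - move=> t /PC[_ nd cd]; have D := DG _ (nbhs_singleton nd).
    split; first by case: D.
    rewrite /prop_for /continuous_at -(dGE _ (nbhs_singleton nd)).
    have H0 : derive1 (F \o gam) s 0 i @[s --> t] --> derive1 (F \o gam) t 0 i.
      exact: (cvg_comp _ _ cd (@coord_continuous R 1 2 0 i _)).
    have H : k * (derive1 (F \o gam) s 0 i) @[s --> t] -->
        k * (derive1 (F \o gam) t 0 i).
      exact: (cvgM (cvg_cst k) H0).
    have N : \forall s \near t, k *: (derive1 (F \o gam) s 0 i) = derive1 G s.
      by apply: filterS nd => s ds; exact: dGE.
    exact: (cvg_trans (near_eq_cvg N) H).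
  - move=> t tab; have [_ nd _] := PC t tab.
    rewrite -(dGE _ (nbhs_singleton nd)); apply: le_trans (cs t tab).
    rewrite (le_trans (ler_norm _))// normrZ kc.
    by apply: ler_wpM2l; [exact: ltW|exact: entry_le_norm].
have coordN i : ((c * `|(F (gam 1) - F (gam a)) 0 i|)%:E <= curve_length ch g gam)%E.
  have [x0|x0] := leP 0 ((F (gam 1) - F (gam a)) 0 i).
    by rewrite (ger0_norm x0); apply: coord; exact: gtr0_norm.
  rewrite (ltr0_norm x0) mulrN -mulNr; apply: coord.
  by rewrite normrN gtr0_norm.
move: coordN; case: (curve_length ch g gam) => [l|_|/(_ ord0)//].
  move=> H; rewrite lee_fin mulrC -ler_pdivlMr//.
  apply: norm_le_entries => [|i].
    have := H ord0; rewrite lee_fin => h; rewrite divr_ge0 ?(ltW c0)//.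
    by rewrite (le_trans _ h)// mulr_ge0// ltW.
  by rewrite ler_pdivlMr// mulrC -lee_fin.
by rewrite leey.
Qed.

(** The passage from Riemannian distance to topology, through which completeness yields limits in
    [T]. The radius [c * rho] is the length below which a curve cannot move its projection by [rho]
    while on the sheet. *)
Lemma dist_small_near p (W : set T) : nbhs p W ->
  exists2 e : R, 0 < e & forall q, (dist q p < e%:E)%E -> W q.
Proof.
move=> pW.
have [r [c [sigma [[r0 c0] BO [sB sp] oN low]]]] := local_section p.
set y0 := F p in BO sB sp oN low.
have : \forall y \near y0, ball y0 r y /\ W (sigma y).
  near=> y; split; near: y.
    exact: (open_nbhs_nbhs (conj (ball_open _ _) (ballxx _ r0))).
  by apply: (sB y0 (ballxx _ r0)).1; rewrite sp.
move=> /nbhs_normP[r1 r10 Hr1].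
pose rho := r1 / 2.
have rho0 : 0 < rho by rewrite divr_gt0.
have Hrho y : `|y - y0| <= rho -> ball y0 r y /\ W (sigma y).
  move=> h; apply: Hr1; rewrite /= distrC (le_lt_trans h)//.
  by rewrite /rho; move: r10 => /=; lra.
exists (c * rho); first exact: mulr_gt0.
move=> q /ereal_inf_lt[_ [gam [g0 g1 gC]] <- len].
have c1 t : 0 <= t <= 1 -> C1_at ch gam t by move=> /gC[].
(* The curve, run backwards from [p], cannot leave [sigma] of the closed ball of
   radius [rho]: up to the exit time its projection moves by less than [rho]. *)
pose P (t : R) := `|F (gam (1 - t)) - y0| <= rho /\
  sigma (F (gam (1 - t))) = gam (1 - t).
have flip (t : R) : 0 <= t <= 1 -> 0 <= 1 - t <= 1 by lra.
suff /(_ 1) : forall t, 0 <= t <= 1 -> P t.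
  rewrite ler01 lexx => /(_ isT); rewrite /P subrr g0 => -[/Hrho[_ Wq] <-].
  exact: Wq.
apply: unit_interval_induction.
- by rewrite /P subr0 g1 /F -/y0 subrr normr0 ltW.
- move=> t t01 Pt.
  have /andP[t0 t1] := t01.
  have [Kt st] : P t by apply: Pt; rewrite t0 lexx.
  have [cg _ _] := c1 _ (flip t t01).
  have nN : \forall z \near 1 - t, [set q | ball y0 r (F q) /\ sigma (F q) = q] (gam z).
    apply: cg; apply: open_nbhs_nbhs; split => //.
    by split; [have [] := Hrho _ Kt|exact: st].
  move: nN => /nbhs_normP[e e0 He].
  apply/nbhs_normP; exists e => // s; rewrite /= => ts /andP[s0 s1].
  (* The length estimate needs the sheet on all of [1 - s, 1]: [P] provides it back to [1 - t],
     openness of the sheet provides the rest. *)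
  have Ns z : 1 - s <= z <= 1 -> ball y0 r (F (gam z)) /\ sigma (F (gam z)) = gam z.
    move=> /andP[sz z1]; have [zt|tz] := leP (1 - z) t.
      have : P (1 - z) by apply: Pt; rewrite zt; lra.
      by rewrite /P subKr => -[/Hrho[]].
    by apply: He => /=; move: ts; rewrite ltr0_norm ?gtr0_norm; lra.
  have [_ ss] := Ns (1 - s) ltac:(lra).
  split => //.
  have s01 : 0 <= 1 - s <= 1 by lra.
  have := displacement_le_length s01 c0 c1 (fun z hz => low gam z
    (c1 z ltac:(lra)) (Ns z hz)).
  move=> /le_lt_trans /(_ len); rewrite lte_fin ltr_pM2l// g1 distrC.
  exact: ltW.
- move=> t /andP[t0 t1] Pt.
  have t01 : 0 <= t <= 1 by rewrite ltW.
  have [cg _ _] := c1 _ (flip t t01).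
  have cg1 : gam (1 - s) @[s --> t^'-] --> gam (1 - t).
    apply: cvg_at_left_filter.
    have cs : (1 - s) @[s --> t] --> 1 - t by apply: cvgB; [exact: cvg_cst|exact: cvg_id].
    exact: (cvg_comp _ _ cs cg).
  have cF1 : F (gam (1 - s)) @[s --> t^'-] --> F (gam (1 - t)).
    exact: (cvg_comp _ _ cg1 (@F_continuous _)).
  have nP : \forall s \near t^'-, P s.
    near=> s; apply: Pt; apply/andP; split; near: s.
      exact: nbhs_left_ge.
    exact: nbhs_left_lt.
  (* The closed bound by [rho] survives in the limit, which therefore stays where [sigma] is
     continuous; Hausdorff separation then identifies the two left limits. *)
  have K : `|F (gam (1 - t)) - y0| <= rho.
    have cn : `|F (gam (1 - s)) - y0| @[s --> t^'-] --> `|F (gam (1 - t)) - y0|.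
      exact: (cvg_norm (cvgB cF1 (cvg_cst y0))).
    have nK : \forall s \near t^'-, `|F (gam (1 - s)) - y0| <= rho.
      by apply: filterS nP => s [].
    exact: (closed_cvg _ (@closed_le R rho) nK _ cn).
  split => //.
  have [By _] := Hrho _ K.
  have cs1 : sigma (F (gam (1 - s))) @[s --> t^'-] --> sigma (F (gam (1 - t))).
    exact: (cvg_comp _ _ cF1 (sB _ By).1).
  have N : \forall s \near t^'-, gam (1 - s) = sigma (F (gam (1 - s))).
    by apply: filterS nP => s [_ ->].
  exact: (cvg_unique T_hausdorff cs1 (cvg_trans (near_eq_cvg N) cg1)).
Unshelve. all: by end_near. Qed.

(** Along the segment, agreement is a closed condition as [T] is Hausdorff, and an open one as [F]
    is injective on a sheet. *)
Lemma lift_unique (V : set 'rV[R]_2) (s1 s2 : 'rV[R]_2 -> T) (a b : 'rV[R]_2) :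
  open V -> section_on s1 V -> section_on s2 V ->
  (forall t : R, 0 <= t <= 1 -> V (seg a b t)) -> s1 a = s2 a -> s1 b = s2 b.
Proof.
move=> oV S1 S2 sV e.
suff /(_ 1) : forall t : R, 0 <= t <= 1 -> s1 (seg a b t) = s2 (seg a b t).
  by rewrite ler01 lexx segment_curve1 => /(_ isT).
have c1 (t : R) : 0 <= t <= 1 -> s1 (seg a b z) @[z --> t] --> s1 (seg a b t).
  move=> t01; exact: (cvg_comp _ _ (@segment_curve_continuous R a b t) (S1 _ (sV _ t01)).1).
have c2 (t : R) : 0 <= t <= 1 -> s2 (seg a b z) @[z --> t] --> s2 (seg a b t).
  move=> t01; exact: (cvg_comp _ _ (@segment_curve_continuous R a b t) (S2 _ (sV _ t01)).1).
apply: unit_interval_induction.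
- by rewrite segment_curve0.
- move=> t t01 Pt.
  have et : s1 (seg a b t) = s2 (seg a b t).
    by apply: Pt; move/andP: t01 => [-> _]; rewrite lexx.
  have [r [c [sigma [[r0 _] _ [_ sp] oN _]]]] := local_section (s1 (seg a b t)).
  set N := [set q | _] in oN.
  have Np : N (s1 (seg a b t)) by split => //; exact: ballxx.
  have n1 : \forall z \near t, N (s1 (seg a b z)).
    by apply: (c1 _ t01); exact: open_nbhs_nbhs.
  have n2 : \forall z \near t, N (s2 (seg a b z)).
    by apply: (c2 _ t01); rewrite -et; exact: open_nbhs_nbhs.
  apply: filterS2 n1 n2 => z [_ e1] [_ e2] z01.
  by rewrite -e1 -e2 (S1 _ (sV _ z01)).2 (S2 _ (sV _ z01)).2.
- move=> t /andP[t0 t1] Pt.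
  have t01 : 0 <= t <= 1 by rewrite ltW.
  have l1 := cvg_at_left_filter (c1 _ t01).
  have l2 := cvg_at_left_filter (c2 _ t01).
  have N : \forall s \near t^'-, s2 (seg a b s) = s1 (seg a b s).
    near=> s; apply/esym/Pt; apply/andP; split; near: s.
      exact: nbhs_left_ge.
    exact: nbhs_left_lt.
  exact: (cvg_unique T_hausdorff l1 (cvg_trans (near_eq_cvg N) l2)).
Unshelve. all: by end_near. Qed.

(** * Limits of lifts from completeness *)

Hypothesis T_complete : complete_metric ch [set: T] g.

Lemma cauchy_converges (u : nat -> T) :
  (forall e : R, 0 < e -> exists N : nat, forall m n : nat,
     (N <= m)%N -> (N <= n)%N -> (dist (u m) (u n) < e%:E)%E) ->
  exists p : T, u n @[n --> \oo] --> p.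
Proof.
move=> /(T_complete (fun=> I)) [p _ up]; exists p => W /= pW.
have [e e0 We] := dist_small_near pW.
have [N HN] := up e e0.
by exists N => // n /= Nn; apply: We; exact: HN.
Qed.

Lemma radial_limit (U : set 'rV[R]_2) (s : 'rV[R]_2 -> T) (c x : 'rV[R]_2) :
  open U -> section_on s U ->
  (forall t : R, 0 <= t < 1 -> U (seg c x t)) ->
  (forall t : R, 0 <= t <= 1 -> Omega (seg c x t)) ->
  exists2 p, F p = x & s (seg c x (1 - harmonic n)) @[n --> \oo] --> p.
Proof.
move=> oU sU Useg Oseg.
pose t (n : nat) : R := 1 - harmonic n.
have h0 n : 0 < (harmonic n : R) by rewrite /harmonic invr_gt0.
have h1 n : (harmonic n : R) <= 1 by rewrite /harmonic invf_le1// ler1n.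
have t01 n : 0 <= t n < 1.
  by rewrite /t subr_ge0 h1/= ltrBlDr ltrDl h0.
have [M M0 HM] : exists2 M : R, 0 < M & forall z, 0 <= z <= 1 ->
    (delta (seg c x z))^-1 <= M.
  have [||z0 _ Hz] := @EVT_max R (fun z => (delta (seg c x z))^-1) 0 1.
  - exact: ler01.
  - apply: continuous_in_subspaceT => z; rewrite inE/= in_itv/= => z01.
    have dz : delta (seg c x z) != 0 by rewrite gt_eqF// delta_pos//; exact: Oseg.
    have cd := cvg_comp _ _ (@segment_curve_continuous R c x z) (delta_continuous (Oseg _ z01)).
    exact: (cvgV dz cd).
  exists (`|(delta (seg c x z0))^-1| + 1); first by rewrite ltr_wpDl.
  move=> z z01; apply: le_trans (Hz z _) _; first by rewrite in_itv.
  by rewrite (le_trans (ler_norm _))// lerDl.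
have [|p up] := @cauchy_converges (fun n => s (seg c x (t n))).
  (* [M * (2 * |x - c|)] bounds the length of the ray per unit of parameter; adding 1 keeps [K]
     positive when [x = c]. *)
  move=> e e0; pose K := M * (2 * `|x - c|) + 1.
  have K0 : 0 < K by rewrite ltr_wpDl// !mulr_ge0// ltW.
  have [N _ HN] : \forall n \near \oo, `|(harmonic n : R)| < e / K.
    have /cvgrPdist_lt/(_ (e / K)) := @cvg_harmonic R.
    rewrite divr_gt0// => /(_ isT); apply: filterS => n.
    by rewrite sub0r normrN.
  exists N => m n Nm Nn.
  have sE z : seg (seg c x (t m)) (seg c x (t n)) z = seg c x (t m + z * (t n - t m)).
    exact: segment_curve_split.
  have inU z : 0 <= z <= 1 -> 0 <= t m + z * (t n - t m) < 1.
    move: (t01 m) (t01 n) => /andP[a0 a1] /andP[b0 b1] /andP[z0 z1]; apply/andP; split.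
      by have -> : t m + z * (t n - t m) = (1 - z) * t m + z * t n; [ring|rewrite addr_ge0// mulr_ge0// subr_ge0].
    move: a1 b1; rewrite -![_ < 1]subr_gt0.
    move: (t m) (t n) => a b a1 b1.
    move: z1; rewrite le_eqVlt => /predU1P[->|z1]; first by lra.
    have p1 : 0 < (1 - z) * (1 - a) by rewrite mulr_gt0// subr_gt0.
    have p2 : 0 <= z * (1 - b) by rewrite mulr_ge0// ltW.
    by nra.
  have C1U : C1_curve (@plane_chart R) U (seg c x (t m)) (seg c x (t n))
      (seg (seg c x (t m)) (seg c x (t n))).
    by apply: segment_C1 => z z01; rewrite sE; apply/Useg/inU.
  have := dist_lift_le_length oU sU C1U.
  move=> /le_lt_trans; apply.
  apply: (@le_lt_trans _ _ (M * (2 * `|seg c x (t n) - seg c x (t m)|))%:E).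
    apply: segment_length_le => z z01; rewrite sE.
    have /andP[i0 i1] := inU z z01.
    have i01 : 0 <= t m + z * (t n - t m) <= 1 by rewrite i0 ltW.
    by split; [exact/delta_pos/Oseg|exact: HM].
  rewrite lte_fin.
  have -> : seg c x (t n) - seg c x (t m) = (t n - t m) *: (x - c).
    by apply/rowP => i; rewrite /segment_curve !mxE; ring.
  have tK : `|t n - t m| < e / K.
    have := HN m Nm; rewrite /= (gtr0_norm (h0 m)) => hm.
    have := HN n Nn; rewrite /= (gtr0_norm (h0 n)) => hn.
    have := h0 m; have := h0 n => n0 m0.
    have -> : t n - t m = harmonic m - harmonic n by rewrite /t; ring.
    by rewrite ltr_norml; apply/andP; split; lra.
  rewrite normrZ; apply: (@le_lt_trans _ _ (`|t n - t m| * K)).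
    have -> : M * (2 * (`|t n - t m| * `|x - c|)) =
      `|t n - t m| * (M * (2 * `|x - c|)) by ring.
    by rewrite ler_wpM2l// lerDl.
  by rewrite -ltr_pdivlMr.
exists p => //.
have c1 : F (s (seg c x (t n))) @[n --> \oo] --> F p.
  exact: (cvg_comp _ _ up (@F_continuous p)).
have c2 : seg c x (t n) @[n --> \oo] --> seg c x 1.
  have ct : t n @[n --> \oo] --> (1 : R).
    apply/cvgrPdist_lt => e e0; have /cvgrPdist_lt/(_ e e0) := @cvg_harmonic R.
    by apply: filterS => n; rewrite /t subKr sub0r normrN.
  exact: (cvg_comp _ _ ct (@segment_curve_continuous R c x 1)).
rewrite segment_curve1 in c2.
have N : \forall n \near \oo, seg c x (t n) = F (s (seg c x (t n))).
  by apply: nearW => n; exact: esym (sU _ (Useg _ (t01 n))).2.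
exact: (cvg_unique (@norm_hausdorff _ _) c1 (cvg_trans (near_eq_cvg N) c2)).
Unshelve. all: by end_near. Qed.

(** * Lifting along the rays from a center *)

Section RadialSection.
Variables (O : set 'rV[R]_2) (c : 'rV[R]_2) (o : T).
Hypothesis O_open : open O.
Hypothesis O_sub : O `<=` Omega.
Hypothesis O_c : O c.
Hypothesis O_star : forall x (t : R), O x -> 0 <= t <= 1 -> O (seg c x t).
Hypothesis Fo : F o = c.

(** Domains star-shaped about [c] have star-shaped intersections, on which [lift_unique] along the
    rays forces two sections to agree. *)
Definition radial_section (U : set 'rV[R]_2) (s : 'rV[R]_2 -> T) : Prop :=
  [/\ open U, U `<=` O, U c /\ s c = o,
      forall x (t : R), U x -> 0 <= t <= 1 -> U (seg c x t) &
      section_on s U].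

Lemma radial_section_eq U1 U2 s1 s2 x : radial_section U1 s1 ->
  radial_section U2 s2 -> U1 x -> U2 x -> s1 x = s2 x.
Proof.
move=> [oU1 _ [c1 e1] st1 S1] [oU2 _ [c2 e2] st2 S2] x1 x2.
apply: (lift_unique (V := U1 `&` U2) (a := c)).
- exact: openI.
- by move=> y [/S1].
- by move=> y [_ /S2].
- by move=> t t01; split; [exact: st1|exact: st2].
- by rewrite e1 e2.
Qed.

Lemma radial_section_base : exists U s, radial_section U s.
Proof.
have [r [e [sigma [[r0 _] _ [sS so] _ _]]]] := local_section o.
rewrite Fo in sS so.
have : \forall y \near c, O y by exact: open_nbhs_nbhs.
move=> /nbhs_ballP[r1 r10 Hr1].
pose r2 := Num.min r r1; have r20 : 0 < r2 by rewrite lt_min r0 r10.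
have Bc : ball c r2 c by exact: ballxx.
exists (ball c r2), sigma; split.
- exact: ball_open.
- by move=> y By; apply: Hr1; apply: le_ball By; rewrite ge_min lexx orbT.
- by [].
- by move=> x t Bx t01; exact: ball_segment.
- by move=> y By; apply: sS; apply: le_ball By; rewrite ge_min lexx.
Qed.

(** The lift of the half-open ray has a limit [p] above [x]. The lifted points end up on the sheet
    of [p], so a local section [sigma] through [p] agrees with [s] near some point of the ray, and
    can be glued to [s]. *)
Lemma radial_section_extend U s x : radial_section U s -> O x ->
  (forall t : R, 0 <= t < 1 -> U (seg c x t)) ->
  exists U' s', radial_section U' s' /\ U' x.
Proof.
move=> [oU UO [Uc sc] Ust sS] Ox Useg.
have [p Fp slim] := radial_limit oU sS Useg
  (fun t h => O_sub (O_star Ox h)).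
have [r [e [sigma [[r0 _] _ [gS gp] oN _]]]] := local_section p.
rewrite Fp in gS gp oN.
set N := [set q | _] in oN.
have : \forall y \near x, O y by exact: open_nbhs_nbhs.
move=> /nbhs_ballP[r1 r10 Hr1].
pose r2 := Num.min r r1; have r20 : 0 < r2 by rewrite lt_min r0 r10.
pose B := ball x r2.
have oB : open B by exact: ball_open.
have Bx : B x by exact: ballxx.
have BO : B `<=` O.
  by move=> y By; apply: Hr1; apply: le_ball By; rewrite ge_min lexx orbT.
have gB : section_on sigma B.
  by move=> y By; apply: gS; apply: le_ball By; rewrite ge_min lexx.
pose W : set 'rV[R]_2 := [set w | [/\ U w, B w & s w = sigma w]].
have [l [l0 l1] Wl] : exists2 l : R, 0 < l /\ l < 1 & nbhs (seg c x l) W.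
  have Np : N p by rewrite /N /= Fp gp; split => //; exact: ballxx.
  have n1 : \forall n \near \oo, N (s (seg c x (1 - harmonic n))).
    by apply: slim; exact: open_nbhs_nbhs.
  have ct : (1 - harmonic n : R) @[n --> \oo] --> (1 : R).
    apply/cvgrPdist_lt => d d0; have /cvgrPdist_lt/(_ d d0) := @cvg_harmonic R.
    by apply: filterS => n; rewrite subKr sub0r normrN.
  have n2 : \forall n \near \oo, B (seg c x (1 - harmonic n)).
    have cs := cvg_comp _ _ ct (@segment_curve_continuous R c x 1).
    by apply: cs; rewrite segment_curve1; exact: open_nbhs_nbhs.
  (* As [harmonic 0 = 1], the index 0 would give the parameter [l = 0], by which the rays could not
     be rescaled later. *)
  have [n [Nn Bn n0]] : exists n : nat, [/\ N (s (seg c x (1 - harmonic n))),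
      B (seg c x (1 - harmonic n)) & (0 < n)%N].
    have n3 : \forall n \near \oo, (0 < n)%N by exact: nbhs_infty_gt.
    have [n [[a b] d]] := filter_ex (filterI (filterI n1 n2) n3).
    by exists n; split.
  exists (1 - harmonic n).
    rewrite subr_gt0 ltrBlDr ltrDl /harmonic invr_gt0 ltr0n.
    by split => //; rewrite invf_lt1// ltr1n.
  set z := seg c x _ in Nn Bn *.
  have Uz : U z.
    by apply: Useg; rewrite subr_ge0 ltrBlDr ltrDl /harmonic invr_gt0 ltr0n invf_le1// ler1n.
  have m1 : \forall w \near z, U w by exact: open_nbhs_nbhs.
  have m2 : \forall w \near z, B w by exact: open_nbhs_nbhs.
  have m3 : \forall w \near z, N (s w).
    by apply: (sS _ Uz).1; exact: open_nbhs_nbhs.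
  apply: filterS3 m1 m2 m3 => w Uw Bw [_ Ew]; split => //.
  by rewrite -[LHS]Ew (sS _ Uw).2.
(* The rays from [c] to points of [D] reach [B] inside [W], where [s] and [sigma]
   agree: this keeps [U `|` D] star-shaped and glues [sigma] to [s]. *)
pose D : set 'rV[R]_2 := [set y | B y /\ exists2 m : R, 0 < m <= 1 & nbhs (seg c y m) W].
have oD : open D.
  rewrite openE => y /= [By [m m01 Wm]].
  have k1 : \forall z \near y, B z by exact: open_nbhs_nbhs.
  have k2 : \forall z \near y, nbhs (seg c z m) W.
    exact: (@segment_curve_continuous_end R c m y _ (nbhs_interior Wm)).
  by apply: filterS2 k1 k2 => z Bz Wz; split => //; exists m.
have Dx : D x by split => //; exists l => //; rewrite l0 ltW.
have agree y : U y -> D y -> s y = sigma y.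
  move=> Uy [By [m /andP[m0 m1] /nbhs_singleton[Um Bm Em]]].
  apply: (lift_unique (V := U `&` B) (a := seg c y m)).
  - exact: openI.
  - by move=> z [/sS].
  - by move=> z [_ /gB].
  - move=> t t01; split; last exact: ball_segment.
    rewrite -{2}(segment_curve1 c y) segment_curve_split; apply: Ust => //.
    by move: t01 => /andP[t0 t1]; nra.
  - exact: Em.
pose s' y := if y \in U then s y else sigma y.
have s'U y : U y -> s' y = s y by move=> Uy; rewrite /s' mem_set.
have s'D y : D y -> s' y = sigma y.
  move=> Dy; rewrite /s'; case: ifPn => // /set_mem Uy; exact: agree.
exists (U `|` D), s'; split; last by right.
split.
- exact: openU.
- by move=> y [/UO//|[/BO]].
- by split; [left|rewrite s'U].
(* Up to the parameter [m], where the ray meets [W], its points are in the star-shaped [U]. From [m]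
   on they are in the convex [B], and [m / t] is the parameter that puts them in [D]. *)
- move=> y t [Uy|[By [m /andP[m0 m1] Wm]]] /andP[t0 t1].
    by left; apply: Ust => //; rewrite t0.
  have [mt|tm] := leP m t.
    have tpos : 0 < t by exact: lt_le_trans mt.
    right; split.
      have [_ Bm _] := nbhs_singleton Wm.
      move: m1; rewrite le_eqVlt => /predU1P[m1|m1].
        have -> : t = 1 by apply/le_anti; rewrite t1 -m1.
        by rewrite segment_curve1.
      have d0 : 0 < 1 - m by rewrite subr_gt0.
      have -> : seg c y t = seg (seg c y m) y ((t - m) / (1 - m)).
        rewrite -[y in RHS](segment_curve1 c y) segment_curve_nest mulr1.
        rewrite segment_curve_split divfK ?gt_eqF//; congr (seg _ _ _); ring.
      apply: ball_segment => //; rewrite divr_ge0 ?subr_ge0 ?(ltW m1)//=.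
      by rewrite ler_pdivrMr// mul1r lerB.
    exists (m / t); first by rewrite divr_gt0// ler_pdivrMr// mul1r.
    by rewrite segment_curve_nest mulfVK// gt_eqF.
  left; have [Um _ _] := nbhs_singleton Wm.
  have -> : seg c y t = seg c (seg c y m) (t / m).
    by rewrite segment_curve_nest mulfVK// gt_eqF.
  by apply: Ust => //; rewrite divr_ge0 ?(ltW m0)//= ler_pdivrMr// mul1r ltW.
- move=> y [Uy|Dy].
    split; last by rewrite s'U//; exact: (sS _ Uy).2.
    have k : \forall z \near y, s z = s' z.
      have : \forall z \near y, U z by exact: open_nbhs_nbhs.
      by apply: filterS => z /s'U.
    rewrite /prop_for /continuous_at (s'U _ Uy).
    exact: (cvg_trans (near_eq_cvg k) (sS _ Uy).1).
  split; last by rewrite s'D//; exact: (gB _ Dy.1).2.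
  have k : \forall z \near y, sigma z = s' z.
    have : \forall z \near y, D z by exact: open_nbhs_nbhs.
    by apply: filterS => z /s'D.
  rewrite /prop_for /continuous_at (s'D _ Dy).
  exact: (cvg_trans (near_eq_cvg k) (gB _ Dy.1).1).
Qed.

Theorem radial_lift : exists s, section_on s O /\ s c = o.
Proof.
pose U : set 'rV[R]_2 := [set x | exists U s, radial_section U s /\ U x].
pose Q (x : 'rV[R]_2) (y : T) := exists U s, [/\ radial_section U s, U x & s x = y].
(* Values are chosen pointwise among those of all radial sections; [radial_section_eq] makes them
   independent of the choice, so [s] is locally one of these sections and inherits continuity. *)
have [s sQ] : exists s : 'rV[R]_2 -> T, forall x, U x -> Q x (s x).
  have : forall x, exists y, U x -> Q x y.
    move=> x; have [[V [s [Vs Vx]]]|nUx] := pselect (U x).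
      by exists (s x) => _; exists V, s.
    by exists o.
  by move=> /choice[s Hs]; exists s.
have sE V s1 x : radial_section V s1 -> V x -> s x = s1 x.
  move=> R1 Vx; have [|V2 [s2 [R2 V2x <-]]] := sQ x; first by exists V, s1.
  exact: radial_section_eq R2 R1 V2x Vx.
have [V0 [s0 R0]] := radial_section_base.
have Uc : U c by exists V0, s0; split => //; case: R0 => _ _ [].
have RU : radial_section U s.
  split.
  - rewrite openE => x /= [V [s1 [R1 Vx]]].
    have oV : open V by case: R1.
    have : \forall y \near x, V y by exact: open_nbhs_nbhs.
    by apply: filterS => y Vy; exists V, s1.
  - by move=> x [V [s1 [[_ VO _ _ _] /VO]]].
  - by split => //; case: (R0) => _ _ [V0c <-] _ _; apply: sE R0 V0c.
  - move=> x t [V [s1 [R1 Vx]]] t01; exists V, s1; split => //.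
    by case: R1 => _ _ _ + _; apply.
  - move=> x [V [s1 [R1 Vx]]]; have [oV _ _ _ S1] := R1.
    split; last by rewrite (sE V s1)//; exact: (S1 _ Vx).2.
    have k : \forall y \near x, s1 y = s y.
      have : \forall y \near x, V y by exact: open_nbhs_nbhs.
      by apply: filterS => y Vy; rewrite (sE V s1).
    rewrite /prop_for /continuous_at (sE V s1 x R1 Vx).
    exact: (cvg_trans (near_eq_cvg k) (S1 _ Vx).1).
have OU : O `<=` U.
  move=> x Ox; have [oU _ _ _ _] := RU.
  suff /(_ 1) : forall t : R, 0 <= t <= 1 -> U (seg c x t).
    by rewrite ler01 lexx segment_curve1; apply.
  apply: unit_interval_induction.
  - by rewrite segment_curve0.
  - move=> t t01 Ut.
    have Uxt : U (seg c x t).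
      by apply: Ut; move/andP: t01 => [-> _]; rewrite lexx.
    have : \forall z \near t, U (seg c x z).
      by apply: (@segment_curve_continuous R c x t); exact: open_nbhs_nbhs.
    by apply: filterS.
  (* The extension past the open ray is itself a radial section, hence already part of the union. *)
  - move=> t /andP[t0 t1] Ut.
    have [||V [s1 [R1 V1]]] := radial_section_extend (x := seg c x t) RU.
    + by apply: O_star => //; rewrite ltW.
    + move=> z /andP[z0 z1]; rewrite segment_curve_nest; apply: Ut.
      by rewrite mulr_ge0 ?(ltW t0)//= gtr_pMl.
    + by exists V, s1.
have [_ _ [_ sc] _ sS] := RU.
by exists s; split => // x /OU/sS.
Qed.

End RadialSection.

(** * The global section and its consequences *)

Hypothesis T_connected : connected [set: T].
Hypothesis T_nonempty : [set: T] !=set0.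
Hypothesis Omega_star : star_shaped Omega.

(** By compactness, a segment contained in the open set [Omega] stays in it when its end point moves
    slightly. *)
Lemma visible_set_open (c : 'rV[R]_2) :
  open [set x | forall t : R, 0 <= t <= 1 -> Omega (seg c x t)].
Proof.
rewrite openE => x /= Ox.
have /compact_near_coveringP tube := @segment_compact R 0 1.
apply: filterS (tube _ (nbhs x) (fun y t => Omega (seg c y t)) _ _).
  by move=> y Hy t t01; apply: Hy; rewrite /= in_itv.
move=> t; rewrite /= in_itv/= => t01.
have J : seg c z.2 z.1 @[z --> (t, x)] --> seg c x t.
  have j2 : (z.2 - c) @[z --> (t, x)] --> x - c by exact: (cvgB cvg_snd (cvg_cst c)).
  exact: (cvgD (cvg_cst c) (cvgZ cvg_fst j2)).
exact: (J _ (open_nbhs_nbhs (conj Omega_open (Ox _ t01)))).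
Qed.

(* [Omega] is not star-shaped about [F p0], but its part visible from [F p0] is,
   and it contains the origin. *)
Lemma exists_above_origin : exists o, F o = 0.
Proof.
have [p0 _] := T_nonempty; set c := F p0.
pose O := [set x | forall t : R, 0 <= t <= 1 -> Omega (seg c x t)].
have Oc : O c.
  by move=> t _; rewrite /segment_curve subrr scaler0 addr0; exact: phiO.
have O0 : O 0.
  move=> t /andP[t0 t1]; have -> : seg c 0 t = (1 - t) *: c.
    by apply/rowP => i; rewrite /segment_curve !mxE; ring.
  by apply: Omega_star.2; [exact: phiO|rewrite subr_ge0 t1 gerBl].
have Osub : O `<=` Omega.
  by move=> x /(_ 1); rewrite ler01 lexx segment_curve1; apply.
have Ost x (t : R) : O x -> 0 <= t <= 1 -> O (seg c x t).
  move=> Ox /andP[t0 t1] z /andP[z0 z1]; rewrite segment_curve_nest; apply: Ox.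
  by rewrite mulr_ge0// mulr_ile1.
have [s [sS _]] := radial_lift
  (@visible_set_open c) Osub Oc Ost (erefl : F p0 = c).
by exists (s 0); exact: (sS _ O0).2.
Qed.

Lemma exists_global_section :
  exists2 s, section_on s Omega & forall p, s (F p) = p.
Proof.
have [p0 Fp0] := exists_above_origin.
have st x (t : R) : Omega x -> 0 <= t <= 1 -> Omega (seg 0 x t).
  by move=> Ox t01; rewrite /segment_curve add0r subr0; exact: Omega_star.2.
have [s [sS so]] := radial_lift Omega_open (fun x h => h) Omega_star.1 st Fp0.
exists s => //.
have cF := @F_continuous.
have csF p : s (F q) @[q --> p] --> s (F p).
  exact: (cvg_comp _ _ (cF p) (sS _ (phiO p)).1).
pose B : set T := [set p | s (F p) = p].
have oB : open B.
  (* For [q] near [p], both [q] and [s (F q)] lie on the sheet of [p]; having the same projection,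
     they coincide. *)
  rewrite openE => p /= Bp.
  have [r [c [sigma [[r0 _] _ [_ sp] oN _]]]] := local_section p.
  set N := [set q | _] in oN.
  have Np : N p by split => //; exact: ballxx.
  have n1 : \forall q \near p, N q by exact: open_nbhs_nbhs.
  have n2 : \forall q \near p, N (s (F q)).
    by apply: (csF p); rewrite Bp; exact: open_nbhs_nbhs.
  apply: filterS2 n1 n2 => q [_ e1] [_ e2].
  by rewrite /B /= -e2 (sS _ (phiO q)).2.
have cB : closed B.
  move=> q Bq; apply: T_hausdorff => A W Aq Wq.
  have n1 : \forall z \near q, A (s (F z)) /\ W z.
    by near=> z; split; near: z; [exact: csF|exact: Wq].
  by have [z [Bz [Az Wz]]] := Bq _ n1; exists z; split => //; rewrite -Bz.
have BT : B = setT.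
  apply: T_connected.
  - by exists p0; rewrite /B /= Fp0.
  - by exists B => //; rewrite setTI.
  - by exists B => //; rewrite setTI.
by move=> p; have : B p by rewrite BT.
Unshelve. all: by end_near. Qed.

Lemma entire_graph_of_complete : entire_graph Omega phi.
Proof.
have [s sS sF] := exists_global_section.
split; first by move=> p q e; rewrite -(sF p) -(sF q) /F e.
exists (fun y => (phi (s y)).2); apply/seteqP; split.
  move=> _ [p _ <-]; exists (F p); first exact: phiO.
  by rewrite sF; exact: esym (surjective_pairing _).
move=> _ [y Oy <-]; exists (s y) => //.
by apply: injective_projections => //; exact: (sS _ Oy).2.
Qed.

(** The lifted sequence converges in the topology of [T], so its projection converges in the plane.
    To return to the Riemannian distance of the base, [u n] is joined to the limit by a straight
    segment, on which 1/delta is at most [M]; the margin 1 in [M] makes this bound valid on a whole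
    ball. *)
Lemma base_complete :
  complete_metric (@plane_chart R) Omega (conformal_metric delta).
Proof.
move=> u Ou uC.
have [s sS sF] := exists_global_section.
have [|p up] := cauchy_converges (u := s \o u).
  move=> e e0; have [N HN] := uC e e0; exists N => m n Nm Nn.
  have /ereal_inf_lt[_ [al alC <-] len] := HN m n Nm Nn.
  apply: le_lt_trans len.
  exact: (dist_lift_le_length Omega_open sS alC).
have Oy : Omega (F p) by exact: phiO.
exists (F p) => // e e0.
have cu : u n @[n --> \oo] --> F p.
  have h := cvg_comp _ _ up (@F_continuous p).
  have N : \forall n \near \oo, (F \o (s \o u)) n = u n.
    by apply: nearW => n; exact: (sS _ (Ou n)).2.
  exact: (cvg_trans (near_eq_cvg N) h).
have d0 : 0 < delta (F p) by exact: delta_pos.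
pose M := (delta (F p))^-1 + 1.
have M0 : 0 < M by rewrite ltr_wpDl// invr_ge0 ltW.
have : \forall y \near F p, Omega y /\ (delta y)^-1 <= M.
  have n1 : \forall y \near F p, Omega y by exact: open_nbhs_nbhs.
  have c1 : (delta y)^-1 @[y --> F p] --> (delta (F p))^-1.
    by apply: (cvgV _ (delta_continuous Oy)); rewrite gt_eqF.
  have /cvgrPdist_le/(_ 1 ltr01) n2 := c1.
  apply: filterS2 n1 n2 => y Oy'; rewrite ler_distl => /andP[h _].
  by split => //; rewrite /M; lra.
move=> /nbhs_ballP[r r0 Hr].
have n1 : \forall n \near \oo, ball (F p) r (u n) by apply: cu; exact: nbhsx_ballx.
have n2 : \forall n \near \oo, `|F p - u n| < e / (2 * M).
  by have /cvgrPdist_lt := cu; apply; rewrite divr_gt0// mulr_gt0.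
have [N _ HN] := filterI n1 n2.
exists N => n Nn; have [Bn en] := HN n Nn.
have Bs t : 0 <= t <= 1 -> ball (F p) r (seg (u n) (F p) t).
  by move=> t01; apply: ball_segment => //; exact: ballxx.
apply: (@le_lt_trans _ _ (M * (2 * `|F p - u n|))%:E); last first.
  by rewrite lte_fin mulrA mulrC -ltr_pdivlMr ?mulr_gt0// (mulrC M).
apply: le_trans (segment_length_le _).
  apply: ereal_inf_lbound; exists (seg (u n) (F p)); last by [].
  by apply: segment_C1 => t t01; exact: (Hr _ (Bs _ t01)).1.
by move=> t t01; have [Ot dt] := Hr _ (Bs _ t01); split => //; exact: delta_pos.
Qed.

End SpacelikeSurface.

Theorem lemma11 (R : realType) (Omega : set 'rV[R]_2)
    (delta tau : 'rV[R]_2 -> R)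
    (Omega_open : open Omega) (Omega_star : star_shaped Omega)
    (delta_smooth : smooth_on Omega delta)
    (delta_pos : forall q, Omega q -> 0 < delta q)
    (tau_smooth : smooth_on Omega tau)
    (Sigma : topologicalType) (ch : Sigma -> chart R Sigma)
    (Sigma_surface : connected_smooth_surface ch)
    (phi : Sigma -> 'rV[R]_2 * R)
    (phi_spacelike : spacelike_immersion delta tau Omega ch phi)
    (Sigma_complete :
       complete_metric ch [set: Sigma] (induced_metric delta tau ch phi)) :
  entire_graph Omega phi /\
  complete_metric (@plane_chart R) Omega (conformal_metric delta).
Proof.
have [[chP chp _] hausd _ conn nonempty] := Sigma_surface.
have [phiO [phi_smooth _] phi_riem] := phi_spacelike.
have cd := delta_smooth 0%N; have ct := tau_smooth 0%N.
have cC q := calabi_potential_continuous Omega_open Omega_star delta_pos cd ct (q := q).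
split.
  exact: (entire_graph_of_complete chP chp Omega_open delta_pos cd cC phiO
    phi_smooth phi_riem hausd Sigma_complete conn nonempty Omega_star).
exact: (base_complete chP chp Omega_open delta_pos cd cC phiO
  phi_smooth phi_riem hausd Sigma_complete conn nonempty Omega_star).
Qed.
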